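(* Let $q$ be a prime power and $n\ge1$. (1) Let $I_1,\dots,I_r$ be an arbitrary partition of $\mathcal I_{\le n}$ and let $m_1,\dots,m_r\ge0$ be integers. For any $a\in\mathbf F_q^\times$, the number of square-free $f\in\mathcal P_a(n)$ with exactly $m_i$ factors in $I_i$ for each $i$ is \[ \ll q^{n-1}\prod_{i=1}^r\left(e^{-H(I_i)}\frac{H(I_i)^{m_i}}{m_i!}\right)\left(\frac{m_1}{H(I_1)}+\cdots+\frac{m_r}{H(I_r)}\right). \] (2) Let $I_1,\dots,I_r$ be an arbitrary partition of $\mathcal I^*_{\le 2n}$ and let $m_1,\dots,m_r\ge0$ be integers. The number of square-free $f\in\mathcal P^*_1(2n)$ with exactly $m_i$ factors in $I_i$ for each $i$ is \[ \ll q^{n}\prod_{i=1}^r\left(e^{-H^*(I_i)}\frac{H^*(I_i)^{m_i}}{m_i!}\right)\left(\frac{m_1}{H^*(I_1)}+\cdots+\frac{m_r}{H^*(I_r)}\right). \] (3) Assume $q$ is a square. Let $I_1,\dots,I_r$ be an arbitrary partition of $\mathcal I^\dagger_{\le n}$ and let $m_1,\dots,m_r\ge0$ be integers. For any $a\in U$, the number of square-free $f\in\mathcal P^\dagger_a(n)$ with exactly $m_i$ factors in $I_i$ for each $i$ is \[ \ll q^{(n-1)/2}\prod_{i=1}^r\left(e^{-H^\dagger(I_i)}\frac{H^\dagger(I_i)^{m_i}}{m_i!}\right)\left(\frac{m_1}{H^\dagger(I_1)}+\cdots+\frac{m_r}{H^\dagger(I_r)}\right). \]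
   Context: $X\ll Y$ means $X\le CY$ for an absolute constant $C$. All polynomials are monic over $\mathbf F_q$. For $f$ of degree $n$ with $f(0)\ne0$, let $f^*(X)=X^nf(1/X)/f(0)$; $f$ is $*$-symmetric if $f^*=f$. If $q$ is a square, let $\bar x=x^{q^{1/2}}$ for $x\in\mathbf F_q$, let $\bar f$ be $f$ with this map applied to its coefficients, and let $f^\dagger(X)=X^n\bar f(1/X)/\bar f(0)$; $f$ is $\dagger$-symmetric if $f^\dagger=f$. $U\le\mathbf F_q^\times$ is the cyclic subgroup of order $q^{1/2}+1$. $\mathcal P_a(n)$, $\mathcal P^*_a(n)$, $\mathcal P^\dagger_a(n)$ denote the sets of polynomials of degree $n$ with $f(0)=a$ that are, respectively, unrestricted, $*$-symmetric, $\dagger$-symmetric. A $*$-symmetric polynomial of positive degree is $*$-irreducible if it has no proper $*$-symmetric divisor of positive degree (equivalently, it is irreducible, or of the form $gg^*$ with $g$ irreducible and not $*$-symmetric). The term $\dagger$-irreducible is defined similarly. $\mathcal I_{\le n}$, $\mathcal I^*_{\le n}$, $\mathcal I^\dagger_{\le n}$ are the sets of irreducible, $*$-irreducible, $\dagger$-irreducible polynomials of degree $\le n$, respectively. For sets $I$ of such polynomials, put $H(I)=\sum_{f\in I}q^{-\deg f}$ for $I\subset\mathcal I_{\le n}$, $H^*(I)=\sum_{f\in I}q^{-(\deg f)/2}$ for $I\subset\mathcal I^*_{\le n}$, and $H^\dagger(I)=\sum_{f\in I}q^{-(\deg f)/2}$ for $I\subset\mathcal I^\dagger_{\le n}$. The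 parts of a partition are nonempty. *)

(* Defs.v *)
From HB Require Import structures.
From mathcomp Require Export all_boot all_order all_algebra.
From mathcomp Require Export fingroup cyclic finmap.
From mathcomp Require Export all_classical reals sequences exp.

Set Implicit Arguments.
Unset Strict Implicit.
Unset Printing Implicit Defensive.

Import Order.TTheory GRing.Theory Num.Theory.

Local Open Scope classical_set_scope.
Local Open Scope ring_scope.

Definition deg (F : fieldType) (f : {poly F}) : nat := (size f).-1.

(* Junk value 0 on infinite sets; see [finite_polys] below. *)
Definition ncard (T : choiceType) (A : set T) : nat := #|` fset_set A|.

Definition square_free (F : fieldType) (f : {poly F}) : Prop :=
  forall u : {poly F}, size u != 1%N -> ~~ (u ^+ 2 %| f).

(* X^n f(1/X) / f(0), with n = deg f, expanded on the coefficients of f. *)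
Definition star (F : fieldType) (f : {poly F}) : {poly F} :=
  (f.[0])^-1 *: \sum_(i < size f) f`_i *: 'X^(deg f - i).

(* In what follows s stands for the square root of q = #|F|. *)
Definition bar (F : fieldType) (s : nat) (f : {poly F}) : {poly F} :=
  map_poly (fun x => x ^+ s) f.

(* X^n (bar f)(1/X) / (bar f)(0); note that bar preserves the degree. *)
Definition dagger (F : fieldType) (s : nat) (f : {poly F}) : {poly F} :=
  star (bar s f).

Definition star_symmetric (F : fieldType) : set {poly F} :=
  [set f | [/\ f \is monic, f.[0] != 0 & star f = f]].
Arguments star_symmetric : clear implicits.

Definition dagger_symmetric (F : fieldType) (s : nat) : set {poly F} :=
  [set f | [/\ f \is monic, f.[0] != 0 & dagger s f = f]].
Arguments dagger_symmetric : clear implicits.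

(* Irreducibility relative to a class S of monic polynomials. *)
Definition irreducible_in (F : fieldType) (S : set {poly F}) (f : {poly F}) :
    Prop :=
  [/\ S f, (0 < deg f)%N &
      forall g : {poly F}, S g -> (0 < deg g)%N -> g %| f -> g = f].

Definition P_ (F : fieldType) (a : F) (n : nat) : set {poly F} :=
  [set f | [/\ f \is monic, deg f = n & f.[0] = a]].

Definition Pstar (F : fieldType) (a : F) (n : nat) : set {poly F} :=
  P_ a n `&` star_symmetric F.

Definition Pdagger (F : fieldType) (s : nat) (a : F) (n : nat) :
    set {poly F} :=
  P_ a n `&` dagger_symmetric F s.

Definition irr_le (F : fieldType) (n : nat) : set {poly F} :=
  [set f | [/\ f \is monic, irreducible_poly f & (deg f <= n)%N]].
Arguments irr_le : clear implicits.

Definition irr_star_le (F : fieldType) (n : nat) : set {poly F} :=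
  [set f | irreducible_in (star_symmetric F) f /\ (deg f <= n)%N].
Arguments irr_star_le : clear implicits.

Definition irr_dagger_le (F : fieldType) (s n : nat) : set {poly F} :=
  [set f | irreducible_in (dagger_symmetric F s) f /\ (deg f <= n)%N].
Arguments irr_dagger_le : clear implicits.

Definition Hirr (R : realType) (F : finFieldType) (I : set {poly F}) : R :=
  \sum_(f \in I) (#|F|%:R : R) `^ (- (deg f)%:R).

(* Common formula for H^* and H^dagger. *)
Definition Hsym (R : realType) (F : finFieldType) (I : set {poly F}) : R :=
  \sum_(f \in I) (#|F|%:R : R) `^ (- ((deg f)%:R / 2)).

(* Since f is square-free, its factors in a set of (relatively) irreducible
   polynomials all have multiplicity one, so counting divisors suffices. *)
Definition sqfree_with_factors (F : fieldType) (r : nat)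
    (I : 'I_r -> set {poly F}) (m : 'I_r -> nat) : set {poly F} :=
  [set f | square_free f /\
           forall i, ncard [set p | I i p /\ p %| f] = m i].

Definition poisson_bound (R : realType) (r : nat) (h : 'I_r -> R)
    (m : 'I_r -> nat) : R :=
  (\prod_(i < r) (expR (- h i) * (h i ^+ m i / (m i)`!%:R)))
  * \sum_(i < r) ((m i)%:R / h i).

Lemma finite_polys (F : finFieldType) (n : nat) :
  finite_set [set f : {poly F} | (deg f <= n)%N].
Proof.
pose g (t : n.+1.-tuple F) : {poly F} := Poly t.
have : finite_set (g @` setT) by apply: finite_image; exact: finite_finset.
apply: sub_finite_set => f /= fn.
have sf : (size f <= n.+1)%N by move: fn; rewrite /deg; case: (size f).
exists [tuple f`_i | i < n.+1] => //.
apply/polyP => i; rewrite /g coef_Poly.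
have [ilt|ige] := ltnP i n.+1.
  by rewrite -[i]/(val (Ordinal ilt)) -tnth_nth tnth_mktuple.
by rewrite !nth_default// ?size_tuple// (leq_trans sf).
Qed.

(* Main.v *)
From HB Require Import structures.
From mathcomp Require Import all_field ring lra zify.
Require Import Defs.
Import Order.TTheory GRing.Theory Num.Theory.

(** In each of the three families, a square-free [f] is the product of the set
    of its (relatively) irreducible factors [p], so [deg f] is the sum of the
    [deg p].  If [N] polynomials of degree [n] are to be counted, [n * N] is
    therefore the number of pairs [(f, p)] with [p] a factor of [f], weighted by
    [deg p].  Counting these pairs by the cofactor [g = f / p] instead,
    [g] determines the degree [e = n - deg g] and the constant term of [p], and
    at most [B * x ^ e / e] irreducibles [p] have these (here [x] is [q], or the
    square root of [q] in the symmetric families).  The weight [deg p = e]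
    cancels the denominator, and what is left is [B * x ^ n] times the sum of
    [x ^ (- deg g)] over all [g] with one factor less in some class [I_i].  As
    [x ^ (- deg g)] is multiplicative, this sum is a product of elementary
    symmetric functions, at most [H_i ^ k / k!] each; replacing [m_i] by
    [m_i - 1] produces the factor [m_i / H_i].  This is [weighted_count].

    It remains to divide by [n].  The total weight [H] of all the
    irreducibles involved is at most [log n + O(1)], so that [1 / n] is at most
    a constant times [exp (- H)], the product of the [exp (- H_i)].  This needs the count
    of the irreducibles of each degree with its exact leading constant;
    [poisson_count] combines the two parts.

    The counts all have the same source.  Distinct relative irreducibles are
    coprime, so those dividing a polynomial [G] have total degree at most
    [deg G] ([irreducible_in_count]).  For [G] one takes a binomial
    [X ^ k - c], found by looking at a root [z] in the field with [q ^ d]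
    elements.  The norm of [z] is its power with exponent
    [(q ^ d - 1) / (q - 1)] and is given by the constant term, while symmetry
    makes [1 / z] (or [z ^ (- s)], where [q = s ^ 2]) a conjugate of [z], which
    is an equation [z ^ k = 1] with [k] about the square root of [q ^ d].  A
    relative irreducible which is not irreducible is the product of [g] and
    its image under the symmetry, and both divide a similar binomial. *)

Set Implicit Arguments.
Unset Strict Implicit.
Unset Printing Implicit Defensive.

Local Open Scope ring_scope.

(** * Counting finite sets by the number of elements in each class *)

Section ClassCounts.
Variables (K : finType) (r : nat) (cl : K -> 'I_r).

Definition class_counts (m : 'I_r -> nat) (T : {set K}) : bool :=
  [forall i, #|[set p in T | cl p == i]| == m i].

Definition decr (m : 'I_r -> nat) (i : 'I_r) : 'I_r -> nat :=
  fun j => (m j - (j == i))%N.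

Lemma class_counts_setU1 m (T : {set K}) p :
  p \notin T -> class_counts m (p |: T) -> class_counts (decr m (cl p)) T.
Proof.
move=> pT /forallP h; apply/forallP => i; rewrite /decr.
have /eqP <- := h i; apply/eqP; have [->|ne] := eqVneq i (cl p).
  have -> : [set q in p |: T | cl q == cl p] = p |: [set q in T | cl q == cl p].
    apply/finset.setP => q; rewrite !inE.
    by have [->|//] := eqVneq q p; rewrite eqxx.
  by rewrite cardsU1 !inE (negPf pT) /= add1n subn1.
rewrite subn0; apply: eq_card => q; rewrite !inE.
have [->|//] := eqVneq q p.
by rewrite eq_sym (negPf ne) andbF.
Qed.

(** Marking an element [p] of class [i] of [T] and then removing it is
    injective on pairs [(T, p)], and removing it lowers the [i]-th count. *)
Lemma marked_sum_le (R : realType) (m : 'I_r -> nat) (i : 'I_r)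
    (phi : K -> {set K} -> R) :
  (forall p T, 0 <= phi p T) ->
  \sum_(T : {set K} | class_counts m T) \sum_(p in T | cl p == i) phi p (T :\ p)
  <= \sum_(T : {set K} | class_counts (decr m i) T)
       \sum_(p | cl p == i) phi p T.
Proof.
move=> phi0.
rewrite (exchange_big_dep (fun p => cl p == i))/=; last by move=> T p _ /andP[].
rewrite [leRHS](exchange_big_dep (fun p => cl p == i))//=.
apply: ler_sum => p /eqP clp.
rewrite (reindex_onto (fun T => p |: T) (fun T => T :\ p))/=; last first.
  by move=> T /andP[_ /andP[pT _]]; rewrite finset.setD1K.
rewrite big_mkcond [leRHS]big_mkcond/=; apply: ler_sum => T _.
case: ifP => [/andP[/andP[hT _] /eqP e]|_]; last by case: ifP.
have pT : p \notin T by rewrite -e !inE eqxx.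
have := class_counts_setU1 pT hT; rewrite clp => ->.
by rewrite e eqxx.
Qed.

Variables (R : realType) (w : K -> R).
Hypothesis w_ge0 : forall p, 0 <= w p.

Let H i : R := \sum_(p | cl p == i) w p.
Let P (m : 'I_r -> nat) : R := \prod_(i < r) (H i ^+ m i / (m i)`!%:R).

Let H_ge0 i : 0 <= H i.
Proof. exact: sumr_ge0. Qed.

Lemma class_prod_decr m i : (0 < m i)%N -> H i * P (decr m i) = (m i)%:R * P m.
Proof.
move=> mi; rewrite /P (bigD1 i)//= [in RHS](bigD1 i)//= !mulrA; congr (_ * _).
  rewrite /decr eqxx subn1; case: (m i) mi => [//|k] _ /=.
  rewrite exprS factS natrM invfM.
  have : (k.+1%:R : R) != 0 by rewrite pnatr_eq0.
  have : (k`!%:R : R) != 0 by rewrite pnatr_eq0 -lt0n fact_gt0.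
  by move=> h1 h2; field; rewrite h1 nat1r h2.
by apply: eq_bigr => j /negPf ji; rewrite /decr ji subn0.
Qed.

(** The sum on the left is the product of the elementary symmetric functions
    [e_(m i)] of the weights of class [i], and [e_k <= e_1 ^ k / k!]. *)
Lemma class_weight_le m :
  \sum_(T : {set K} | class_counts m T) \prod_(p in T) w p <= P m.
Proof.
(* Removing a marked element of class [i] lowers the total count by one. *)
move: {2}(\sum_i m i)%N (erefl (\sum_i m i)%N) => k.
elim: k m => [|k IH] m mk.
  have m0 i : m i = 0%N.
    by apply/eqP; move/eqP: mk; rewrite sum_nat_eq0 => /forallP/(_ i).
  rewrite /P [leRHS]big1 => [|i _]; last by rewrite m0 expr0 fact0 divr1.
  rewrite (big_pred1 finset.set0) ?finset.big_set0// => T.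
  apply/forallP/eqP => [h|-> i]; last first.
    rewrite m0 cards_eq0; apply/eqP/finset.setP => q.
    by rewrite !inE.
  apply/finset.setP => q; rewrite !inE; apply/negP => qT.
  have := h (cl q); rewrite m0 cards_eq0 => /eqP/finset.setP/(_ q).
  by rewrite !inE qT eqxx.
have [i mi] : exists i, (0 < m i)%N.
  apply/existsP; apply/contraT; rewrite negb_exists => /forallP h.
  move: mk; rewrite big1// => i _; apply/eqP.
  by have := h i; rewrite -leqNgt leqn0.
have mi0 : 0 < (m i)%:R :> R by rewrite ltr0n.
rewrite -(ler_pM2l mi0) -class_prod_decr//.
have IHi : \sum_(T : {set K} | class_counts (decr m i) T) \prod_(p in T) w p
    <= P (decr m i).
  apply: IH; move: mk; rewrite (bigD1 i)//= => mk; rewrite (bigD1 i)//=.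
  have -> : (\sum_(j | j != i) decr m i j = \sum_(j | j != i) m j)%N.
    by apply: eq_bigr => j /negPf ji; rewrite /decr ji subn0.
  by move: mi mk; rewrite /decr eqxx subn1; case: (m i) => //= k0 _ [].
apply: le_trans (ler_wpM2l (H_ge0 i) IHi).
pose phi (p : K) (T : {set K}) : R := w p * \prod_(q in T) w q.
have := @marked_sum_le R m i phi.
have -> : \sum_(T : {set K} | class_counts m T)
    \sum_(p in T | cl p == i) phi p (T :\ p) =
    (m i)%:R * \sum_(T : {set K} | class_counts m T) \prod_(p in T) w p.
  rewrite mulr_sumr; apply: eq_bigr => T /forallP/(_ i)/eqP <-.
  rewrite -sumr_const mulr_suml.
  rewrite [RHS](eq_bigl (fun p => (p \in T) && (cl p == i))); last first.
    by move=> p; rewrite inE.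
  apply: eq_bigr => p /andP[pT _]; rewrite mul1r /phi.
  by rewrite [in RHS](big_setD1 p).
have -> : \sum_(T : {set K} | class_counts (decr m i) T)
    \sum_(p | cl p == i) phi p T =
    H i * \sum_(T : {set K} | class_counts (decr m i) T) \prod_(p in T) w p.
  rewrite mulr_sumr; apply: eq_bigr => T _.
  by rewrite /H mulr_suml.
apply=> p T; rewrite mulr_ge0//.
by apply: prodr_ge0.
Qed.

End ClassCounts.

Section WeightedCount.
Variables (R : realType) (F : fieldType) (K : finType) (r : nat).
Variables (cl : K -> 'I_r) (d : K -> nat) (c : K -> F) (x B : R).
Hypotheses (x_gt0 : 0 < x) (B_ge0 : 0 <= B).
Hypothesis few : forall e b, b != 0 ->
  e%:R * #|[set p | (d p == e) && (c p == b)]|%:R <= B * x ^+ e.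

Let H i : R := \sum_(p | cl p == i) x ^- d p.
Let P (m : 'I_r -> nat) : R := \prod_(i < r) (H i ^+ m i / (m i)`!%:R).

(** Given all the factors of a product but one, of degree [e] say, the degree
    and the constant term of the product determine those of the missing factor,
    which leaves at most [B * x ^+ e / e] choices for it.  Weighing each factor
    by its degree cancels the denominator. *)
Lemma weighted_count m n a : a != 0 -> (forall i, 0 < H i) ->
  n%:R * #|[set T : {set K} | [&& class_counts cl m T,
             (\sum_(p in T) d p == n)%N & \prod_(p in T) c p == a]]|%:R
  <= B * x ^+ n * (P m * \sum_(i < r) ((m i)%:R / H i)).
Proof.
move=> a0 H0.
(* Since [n] is the total degree of [T], the left side counts pairs of a set [T]
   and a marked [p] in [T], each weighted by [d p]. *)
pose good (T : {set K}) :=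
  ((\sum_(p in T) d p == n)%N) && (\prod_(p in T) c p == a).
pose phi (p : K) (T : {set K}) : R :=
  if ((d p + \sum_(q in T) d q == n)%N) && (c p * \prod_(q in T) c q == a)
  then (d p)%:R else 0.
have phi0 p T : 0 <= phi p T by rewrite /phi; case: ifP.
have -> : n%:R * #|[set T : {set K} | [&& class_counts cl m T,
             (\sum_(p in T) d p == n)%N & \prod_(p in T) c p == a]]|%:R
    = \sum_(i < r) \sum_(T : {set K} | class_counts cl m T)
        \sum_(p in T | cl p == i) phi p (T :\ p).
  rewrite exchange_big/= -sumr_const mulr_sumr.
  rewrite [LHS](eq_bigl (fun T => class_counts cl m T && good T)); last first.
    by move=> T; rewrite inE.
  rewrite big_mkcondr/=; apply: eq_bigr => T _.
  rewrite -(partition_big cl predT)//=.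
  have phiT p : p \in T -> phi p (T :\ p) = if good T then (d p)%:R else 0.
    by move=> pT; rewrite /phi /good (big_setD1 p pT)/= (big_setD1 p pT).
  rewrite (eq_bigr _ phiT); case: ifP => [/andP[/eqP <- _]|_].
    by rewrite mulr1 natr_sum.
  by rewrite big1.
rewrite !mulr_sumr; apply: ler_sum => i _.
have [mi0|mi] := posnP (m i).
  rewrite mi0 mul0r !mulr0 big1// => T /forallP/(_ i).
  rewrite mi0 cards_eq0 => /eqP/finset.setP h; rewrite big1// => p pi.
  by have := h p; rewrite !inE pi.
apply: le_trans (@marked_sum_le K r cl R m i phi phi0) _.
have x0 : x != 0 by rewrite gt_eqF.
have -> : P m * ((m i)%:R / H i) = P (decr m i).
  rewrite mulrA [P m * _]mulrC; apply/eqP.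
  have Hi : H i != 0 by rewrite gt_eqF.
  by rewrite -(class_prod_decr cl _ mi) mulrAC divff ?mul1r.
have h : \sum_(T : {set K} | class_counts cl (decr m i) T)
     \prod_(p in T) x ^- d p <= P (decr m i).
  by apply: class_weight_le => p; rewrite invr_ge0 exprn_ge0 ?ltW.
have Bx : 0 <= B * x ^+ n by rewrite mulr_ge0// exprn_ge0// ltW.
apply: le_trans (ler_wpM2l Bx h); rewrite mulr_sumr; apply: ler_sum => T _.
set D := (\sum_(q in T) d q)%N; set C := \prod_(q in T) c q.
have -> : \prod_(p in T) x ^- d p = x ^- D.
  by rewrite /D; elim/big_rec2: _ => [|p k y _ ->];
    rewrite ?expr0 ?invr1// exprD invfM.
have nn : 0 <= B * x ^+ n * x ^- D.
  by rewrite mulr_ge0// invr_ge0 exprn_ge0// ltW.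
have [C0|C0] := eqVneq C 0.
  rewrite big1// => p _; rewrite /phi -/C C0 mulr0 [0 == a]eq_sym (negPf a0).
  by rewrite andbF.
have [nD|Dn] := ltnP n D.
  rewrite big1// => p _; rewrite /phi -/D; case: eqP => //= e; lia.
have -> : B * x ^+ n * x ^- D = B * x ^+ (n - D).
  by rewrite -mulrA -exprB// unitfE.
apply: le_trans (@few (n - D)%N (a / C) _); last by rewrite mulf_neq0 ?invr_eq0.
rewrite -sumr_const mulr_sumr [leRHS]big_mkcond [leLHS]big_mkcond/=.
apply: ler_sum => p _; rewrite inE /phi -/D -/C.
have -> : (d p + D == n)%N = (d p == n - D)%N by apply/eqP/eqP => h'; lia.
have -> : (c p * C == a) = (c p == a / C).
  by apply/eqP/eqP => [<-|->]; rewrite ?mulfK ?divfK.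
by case: (cl p == i); case: eqP => [e|_]; rewrite ?e; case: eqP => //= _;
  rewrite ?mulr1.
Qed.

End WeightedCount.

(** Each step multiplies the left side by [exp (1 / (n + 1))], and
    [exp (- 1 / (n + 1)) >= n / (n + 1)]. *)
Lemma expR_harmonic (R : realType) (n : nat) : (0 < n)%N ->
  expR (\sum_(k < n) k.+1%:R^-1) <= expR 1 * n%:R :> R.
Proof.
elim: n => // -[|n] IH _; first by rewrite big_ord1 invr1 mulr1.
rewrite big_ord_recr/= expRD.
have n2 : 0 < n.+2%:R :> R by [].
have n1 : 0 < n.+1%:R :> R by [].
have h : expR n.+2%:R^-1 <= n.+2%:R / n.+1%:R :> R.
  have := expR_ge1Dx (- n.+2%:R^-1 : R); rewrite expRN.
  have -> : 1 - n.+2%:R^-1 = (n.+2%:R / n.+1%:R)^-1 :> R.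
    rewrite invf_div; apply: (mulIf (lt0r_neq0 n2)).
    rewrite mulrBl mulVf ?lt0r_neq0// divfK ?lt0r_neq0// mul1r.
    by rewrite -(natr1 n.+1) addrK.
  by rewrite lef_pV2// posrE ?expR_gt0 ?divr_gt0.
apply: le_trans (ler_pM (expR_ge0 _) (expR_ge0 _) (IH isT) h) _.
by rewrite -mulrA [n.+1%:R * _]mulrC divfK// gt_eqF.
Qed.

(** Mertens: [exp (- H) >= exp (- A - 1) / n], which turns the factor [1 / n]
    into the exponentials of the Poisson weights. *)
Lemma poisson_count (R : realType) (F : fieldType) (K : finType) (r : nat)
    (cl : K -> 'I_r) (d : K -> nat) (c : K -> F) (x A B : R) (n N : nat)
    (m : 'I_r -> nat) (a : F) :
  let H i : R := \sum_(p | cl p == i) x ^- d p in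
  0 < x -> 0 <= B ->
  (forall e b, b != 0 ->
     e%:R * #|[set p | (d p == e) && (c p == b)]|%:R <= B * x ^+ e) ->
  \sum_p x ^- d p <= A + \sum_(k < n) k.+1%:R^-1 ->
  (0 < n)%N -> (n <= N)%N -> a != 0 -> (forall i, 0 < H i) ->
  #|[set T : {set K} | [&& class_counts cl m T,
             (\sum_(p in T) d p == N)%N & \prod_(p in T) c p == a]]|%:R
  <= expR (A + 1) * B * (x ^+ N * poisson_bound H m).
Proof.
move=> H x0 B0 few mertens n0 nN a0 H0.
set X := _%:R; have n0' : 0 < n%:R :> R by rewrite ltr0n.
have X0 : 0 <= X by [].
have hN := weighted_count x0 B0 few m N a0 H0.
rewrite /poisson_bound big_split/=; set E := \prod_(i < r) expR _.
move: hN; rewrite -/X.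
set P := \prod_(i < r) _; set S := \sum_(i < r) _ => hN.
have S0 : 0 <= S by apply: sumr_ge0 => i _; rewrite divr_ge0// (ltW (H0 i)).
have P0 : 0 <= P.
  by apply: prodr_ge0 => i _; rewrite divr_ge0// exprn_ge0// (ltW (H0 i)).
have Z0 : 0 <= B * x ^+ N * (P * S).
  by rewrite !mulr_ge0// exprn_ge0// ltW.
(* [E] is [exp (- H)] for the total weight [H] of all classes together. *)
have nE : 1 <= expR (A + 1) * n%:R * E.
  have -> : E = (expR (\sum_p x ^- d p))^-1.
    rewrite (partition_big cl predT)//= -expRN -sumrN expR_sum//.
  rewrite ler_pdivlMr ?expR_gt0// mul1r.
  apply: le_trans (_ : expR (A + \sum_(k < n) k.+1%:R^-1) <= _).
    by rewrite ler_expR.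
  by rewrite !expRD -mulrA ler_pM2l ?expR_gt0// expR_harmonic.
have nX : n%:R * X <= B * x ^+ N * (P * S).
  by apply: le_trans hN; rewrite ler_wpM2r// ler_nat.
rewrite -(ler_pM2l n0'); apply: le_trans nX _.
rewrite -[leLHS]mul1r; apply: le_trans (ler_wpM2r Z0 nE) _.
by rewrite le_eqVlt; apply/orP; left; apply/eqP; ring.
Qed.

Local Open Scope classical_set_scope.
Local Open Scope ring_scope.

(** * Factorization relative to a class of monic polynomials *)

(** The closure properties of a class [S] of monic polynomials which give
    unique factorization into irreducibles relative to [S]; the quotient
    property puts [1] in every nonempty such class. *)
Definition factorization_class (F : fieldType) (S : set {poly F}) : Prop :=
  [/\ forall f, S f -> f \is monic,
      forall f g, S f -> S g -> S (f * g),
      forall f g, S f -> S (f * g) -> S g &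
      forall f g, S f -> S g -> exists2 h, S h & h %= gcdp f g].

Section Factorization.
Variables (F : fieldType) (S : set {poly F}).
Hypothesis SP : factorization_class S.

Let S_monic f : S f -> f \is monic. Proof. by case: SP => h _ _ _; exact: h. Qed.

Let S_size f : S f -> size f = (deg f).+1.
Proof. by move/S_monic/monic_neq0; rewrite /deg -size_poly_gt0; case: (size f). Qed.

Lemma monic_dvdp_eq (f g : {poly F}) :
  f \is monic -> g \is monic -> f %| g -> (deg g <= deg f)%N -> f = g.
Proof.
move=> mf mg fg dfg.
apply/eqP; rewrite -eqp_monic// -dvdp_size_eqp// eqn_leq dvdp_leq ?monic_neq0//=.
move: dfg (mf) (mg); rewrite /deg.
move=> + /monic_neq0 + /monic_neq0; rewrite -!size_poly_gt0.
by case: (size f) (size g) => [|a] [|b].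
Qed.

(** Their gcd has a representative in [S]; if not constant, it equals both. *)
Lemma irreducible_in_coprime p q :
  irreducible_in S p -> irreducible_in S q -> p != q -> coprimep p q.
Proof.
move=> [Sp _ minp] [Sq _ minq] pq.
case: SP => _ _ _ /(_ p q Sp Sq) [h Sh hE].
have hp : h %| p by rewrite (eqp_dvdl _ hE) dvdp_gcdl.
have hq : h %| q by rewrite (eqp_dvdl _ hE) dvdp_gcdr.
rewrite coprimep_def -(eqp_size hE) S_size// eqSS eqn0Ngt.
apply: contra pq => h0.
by rewrite -(minp h Sh h0 hp) -(minq h Sh h0 hq).
Qed.

Lemma irreducible_in_divisor g : S g -> (0 < deg g)%N ->
  exists2 p, irreducible_in S p & p %| g.
Proof.
move: {2}(deg g) (leqnn (deg g)) => k.
elim: k g => [|k IH] g gk Sg g0; first by rewrite ltnNge gk in g0.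
have [[h [Sh h0 hg hne]]|no] :=
    pselect (exists h, [/\ S h, (0 < deg h)%N, h %| g & h <> g]).
  have [hk|] := leqP (deg h) k.
    have [p pi ph] := IH h hk Sh h0.
    by exists p => //; apply: dvdp_trans hg.
  move=> kh; case: hne; apply: monic_dvdp_eq (S_monic Sh) (S_monic Sg) hg _.
  exact: leq_trans gk kh.
exists g => //; split=> // h Sh h0 hg; apply: contrapT => hne.
by apply: no; exists h.
Qed.

Lemma coprime_prod_dvdp (s : seq {poly F}) (G : {poly F}) : uniq s ->
  {in s &, forall p q, p != q -> coprimep p q} ->
  {in s, forall p, p %| G} -> \prod_(p <- s) p %| G.
Proof.
elim: s => [|p s IH]; first by rewrite big_nil dvd1p.
move=> /= /andP[ps us] cop dv; rewrite big_cons Gauss_dvdp.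
  rewrite dv ?mem_head// IH// => [u v us' vs|u us'].
    by apply: cop; rewrite in_cons ?us' ?vs orbT.
  by apply: dv; rewrite in_cons us' orbT.
rewrite big_seq; elim/big_ind: _ => [|u v cu cv|q qs].
- exact: coprimep1.
- by rewrite coprimepMr cu.
apply: cop; rewrite ?mem_head// ?in_cons ?qs ?orbT//.
by apply: contraNneq ps => ->.
Qed.

(** The product [Q] of the irreducible factors divides [f] by coprimality.  An
    irreducible factor of [f / Q] would also divide [Q], and its square [f]. *)
Lemma square_free_prod (s : seq {poly F}) f : uniq s ->
  S f -> square_free f ->
  (forall p, p \in s <-> irreducible_in S p /\ p %| f) ->
  f = \prod_(p <- s) p.
Proof.
move=> us Sf sqf sP.
have Qf : \prod_(p <- s) p %| f.
  apply: coprime_prod_dvdp => // [p q /sP[ip _] /sP[iq _]|p /sP[]//].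
  exact: irreducible_in_coprime.
have S1 : S 1 by case: SP => _ _ /(_ f 1) + _; rewrite mulr1; apply.
have SQ : S (\prod_(p <- s) p).
  rewrite big_seq; elim/big_ind: _ => // [u v|p /sP[[]]//].
  by case: SP => _ + _ _; apply.
set Q := \prod_(p <- s) p in Qf SQ *.
have [g fE] : exists g, f = Q * g.
  by exists (f %/ Q); rewrite mulrC divpK.
have Sg : S g by case: SP => _ _ /(_ Q g SQ) + _; rewrite -fE; apply.
have [g0|] := posnP (deg g).
  have : size g == 1%N by rewrite S_size// g0.
  rewrite fE -[RHS]mulr1 => /size_poly1P[c _ gc]; congr (_ * _).
  by have := S_monic Sg; rewrite gc monicE lead_coefC => /eqP->.
move=> /(irreducible_in_divisor Sg)[p ip pg].
have pf : p %| f by rewrite fE dvdp_mull.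
have pQ : p %| Q by rewrite /Q (big_rem p)/= ?dvdp_mulr//; apply/sP.
have sp : size p != 1%N.
  by case: ip => Sp p0 _; rewrite S_size// eqSS -lt0n.
by have := sqf p sp; rewrite fE expr2 dvdp_mul.
Qed.

(** Relative irreducibles are pairwise coprime, so those dividing [G] have
    total degree at most [deg G]. *)
Lemma irreducible_in_count (s : seq {poly F}) (G : {poly F}) (e : nat) :
  uniq s -> G != 0 ->
  {in s, forall p, [/\ irreducible_in S p, deg p = e & p %| G]} ->
  (e * size s <= deg G)%N.
Proof.
move=> us G0 sP.
have dv : \prod_(p <- s) p %| G.
  apply: coprime_prod_dvdp => // [p q /sP[ip _ _] /sP[iq _ _]|p /sP[]//].
  exact: irreducible_in_coprime.
have sm p : p \in s -> S p /\ deg p = e by move=> /sP[[]].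
have := dvdp_leq G0 dv.
suff -> : size (\prod_(p <- s) p) = (e * size s).+1.
  by rewrite /deg; case: (size G).
elim: s {us sP dv} sm => [|p s IH] sm.
  by rewrite big_nil size_poly1 muln0.
have [Sp dp] := sm p (mem_head _ _).
have sQ : size (\prod_(p <- s) p) = (e * size s).+1.
  by apply: IH => u us; apply: sm; rewrite in_cons us orbT.
have Q0 : \prod_(p <- s) p != 0 by rewrite -size_poly_gt0 sQ.
by rewrite big_cons size_monicM ?S_monic// sQ S_size//= dp mulnS; lia.
Qed.

End Factorization.

(** * Reversal and the involutions it induces *)

(** Raising to a power of the characteristic, packed as a ring morphism so that
    it can be moved through evaluation and reversal. *)
Lemma frobenius_rmorphism (L : fieldType) (t : nat) :
  [pchar L].-nat t -> exists phi : {rmorphism L -> L}, forall x, phi x = x ^+ t.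
Proof.
move=> ht; pose phi (x : L) := x ^+ t.
have t0 : t != 0%N by case: (t) ht.
have phi0 : nmod_morphism phi.
  by split=> [|x y]; rewrite /phi ?expr0n ?(negPf t0)// exprDn_pchar.
have phi1 : monoid_morphism phi.
  by split=> [|x y]; rewrite /phi ?expr1n// exprMn.
pose r : {rmorphism L -> L} := HB.pack phi
  (GRing.isNmodMorphism.Build _ _ phi phi0)
  (GRing.isMonoidMorphism.Build _ _ phi phi1).
by exists r.
Qed.

Section Reversal.
Variable F : fieldType.
Implicit Types f g h : {poly F}.

Definition rev_poly f : {poly F} :=
  \sum_(i < size f) f`_i *: 'X^(deg f - i).

Lemma starE f : star f = (f.[0])^-1 *: rev_poly f.
Proof. by []. Qed.

Lemma coef_rev_poly f j :
  (rev_poly f)`_j = if (j < size f)%N then f`_(deg f - j) else 0.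
Proof.
rewrite coef_sum; have [jf|jf] := ltnP j (size f).
  have dj : (deg f - j < size f)%N by rewrite /deg; lia.
  rewrite (bigD1 (Ordinal dj))//= coefZ coefXn.
  rewrite subKn; last by rewrite /deg; lia.
  rewrite eqxx mulr1 big1 ?addr0// => i ne; rewrite coefZ coefXn.
  case: eqP => [ji|]; last by rewrite mulr0.
  case/eqP: ne; apply/val_inj => /=; have := ltn_ord i.
  move=> il; rewrite ji subKn// /deg -ltnS prednK//; exact: leq_ltn_trans il.
rewrite big1// => i _; rewrite coefZ coefXn.
case: eqP => [ji|]; last by rewrite mulr0.
by have := ltn_ord i; move: ji jf; rewrite /deg; lia.
Qed.

Lemma size_rev_poly f : f.[0] != 0 -> size (rev_poly f) = size f.
Proof.
move=> f0; apply/eqP; rewrite eqn_leq; apply/andP; split.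
  apply/leq_sizeP => j fj; rewrite coef_rev_poly ltnNge fj//.
have fn0 : f != 0 by apply: contraNneq f0 => ->; rewrite horner0.
have : (0 < size f)%N by rewrite size_poly_gt0.
case sf: (size f) => [//|k] _; rewrite ltnNge; apply: contra f0.
move=> /leq_sizeP/(_ k (leqnn k)) /eqP.
by rewrite coef_rev_poly sf ltnSn /deg sf subnn -horner_coef0.
Qed.

Lemma rev_polyK f : f.[0] != 0 -> rev_poly (rev_poly f) = f.
Proof.
move=> f0; apply/polyP => j; rewrite coef_rev_poly size_rev_poly//.
rewrite /deg size_rev_poly// -/(deg f); case: ltnP => [jf|jf].
  rewrite coef_rev_poly ifT; last by rewrite /deg; lia.
  by congr (_`__); rewrite /deg; lia.
by rewrite nth_default.
Qed.

Lemma rev_polyZ (c : F) f : c != 0 -> rev_poly (c *: f) = c *: rev_poly f.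
Proof.
move=> c0; apply/polyP => j; rewrite coefZ !coef_rev_poly /deg size_scale//.
by case: ifP; rewrite ?mulr0// coefZ.
Qed.

Lemma rev_poly_map (phi : {rmorphism F -> F}) f :
  rev_poly (map_poly phi f) = map_poly phi (rev_poly f).
Proof.
apply/polyP => j; rewrite coef_map/= !coef_rev_poly /deg size_map_poly.
by case: ifP; rewrite ?rmorph0// coef_map.
Qed.

Lemma horner_rev_poly (K : fieldType) (iota : {rmorphism F -> K}) (z : K) f :
  z != 0 -> (map_poly iota (rev_poly f)).[z] =
  z ^+ deg f * (map_poly iota f).[z^-1].
Proof.
move=> z0; rewrite rmorph_sum horner_sum.
rewrite (horner_coef_wide _ (n := size f)) ?size_map_poly//.
rewrite mulr_sumr; apply: eq_bigr => i _ /=.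
rewrite map_polyZ map_polyXn hornerZ hornerXn coef_map/=.
rewrite mulrCA exprVn -expfB_cond// (negPf z0) add0n /deg.
have il := ltn_ord i; rewrite -ltnS prednK//; exact: leq_ltn_trans il.
Qed.

(** With [X] invertible, reversal is [X ^+ deg f * f (1 / X)], which is
    visibly multiplicative in [f]; hence the passage to rational fractions. *)
Lemma rev_polyM f g : f != 0 -> g != 0 ->
  rev_poly (f * g) = rev_poly f * rev_poly g.
Proof.
move=> f0 g0; pose i (c : F) : {fraction {poly F}} := tofrac c%:P.
have i0 : nmod_morphism i.
  by split=> [|x y]; rewrite /i ?tofrac0// polyCD tofracD.
have i1 : monoid_morphism i.
  by split=> [|x y]; rewrite /i ?tofrac1// polyCM tofracM.
pose iota : {rmorphism F -> {fraction {poly F}}} := HB.pack i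
  (GRing.isNmodMorphism.Build _ _ i i0) (GRing.isMonoidMorphism.Build _ _ i i1).
have ev h : (map_poly iota h).[tofrac 'X] = tofrac h.
  have -> : map_poly iota h = map_poly (@tofrac {poly F}) (map_poly polyC h).
    by apply/polyP => k; rewrite !coef_map.
  by rewrite horner_map/=; congr tofrac; exact: comp_polyXr.
have X0 : tofrac 'X != 0 :> {fraction {poly F}}.
  by rewrite tofrac_eq0 polyX_eq0.
apply/eqP; rewrite -tofrac_eq; apply/eqP; rewrite tofracM.
rewrite -(ev (rev_poly (f * g))) -(ev (rev_poly f)) -(ev (rev_poly g)).
rewrite !horner_rev_poly//.
rewrite rmorphM hornerM mulrACA -exprD; congr (_ ^+ _ * _).
rewrite /deg size_mul//; move: f0 g0; rewrite -!size_poly_gt0.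
by case: (size f) (size g) => [|u] [|v]//= _ _; rewrite addnS.
Qed.

Lemma size_star f : f.[0] != 0 -> size (star f) = size f.
Proof. by move=> f0; rewrite starE size_scale ?invr_eq0// size_rev_poly. Qed.

Lemma star_monic f : f.[0] != 0 -> star f \is monic.
Proof.
move=> f0; rewrite monicE lead_coefE size_star// starE coefZ coef_rev_poly.
have fn0 : f != 0 by apply: contraNneq f0 => ->; rewrite horner0.
have : (0 < size f)%N by rewrite size_poly_gt0.
rewrite /deg; case: (size f) => //= k _.
by rewrite ltnSn subnn -horner_coef0 mulVf.
Qed.

Lemma star_horner0 f : f \is monic -> (star f).[0] = (f.[0])^-1.
Proof.
move=> mf; rewrite starE hornerZ [X in _ * X]horner_coef0 coef_rev_poly.
rewrite size_poly_gt0 monic_neq0// subn0 -[_`_(deg f)]lead_coefE.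
by rewrite (monicP mf) mulr1.
Qed.

Lemma starK f : f \is monic -> f.[0] != 0 -> star (star f) = f.
Proof.
move=> mf f0; rewrite starE star_horner0// invrK starE rev_polyZ ?invr_eq0//.
by rewrite scalerA divff// scale1r rev_polyK.
Qed.

Lemma starM f g : f.[0] != 0 -> g.[0] != 0 -> star (f * g) = star f * star g.
Proof.
have n0 h : h.[0] != 0 -> h != 0.
  by move=> h0; apply: contraNneq h0 => ->; rewrite horner0.
move=> f0 g0; rewrite !starE rev_polyM ?n0// hornerM invfM.
by rewrite -scalerAl -scalerAr scalerA.
Qed.

Lemma star_map (phi : {rmorphism F -> F}) f :
  star (map_poly phi f) = map_poly phi (star f).
Proof.
rewrite !starE rev_poly_map map_polyZ fmorphV; congr (_ ^-1 *: _).
by rewrite -[in LHS](rmorph0 phi) horner_map.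
Qed.

(** Both kinds of symmetry are instances of [dagger t], with [t ^ 2] acting
    trivially on [F]: [t = 1] for [star], and [t] the square root of [q]. *)
Lemma star_symmetricE : star_symmetric F = dagger_symmetric F 1.
Proof.
apply/funext => f; rewrite /star_symmetric /dagger_symmetric /dagger/=.
suff -> : bar 1 f = f by [].
by apply/polyP => i; rewrite coef_map_id0 ?expr1.
Qed.

End Reversal.

Section Dagger.
Variables (F : fieldType) (t : nat).
Hypotheses (t_char : [pchar F].-nat t) (t_inv : forall x : F, x ^+ (t ^ 2) = x).
Implicit Types f g h : {poly F}.

Let phi : {rmorphism F -> F} := projT1 (cid (frobenius_rmorphism t_char)).
Let phiE x : phi x = x ^+ t.
Proof. exact: (projT2 (cid (frobenius_rmorphism t_char))). Qed.

Let barE f : bar t f = map_poly phi f.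
Proof. by apply/esym; exact: eq_map_poly phiE _. Qed.

Let bar_monic f : f \is monic -> bar t f \is monic.
Proof. by rewrite barE map_monic. Qed.

Lemma bar_horner0 f : (bar t f).[0] = f.[0] ^+ t.
Proof. by rewrite barE -[in LHS](rmorph0 phi) horner_map/= phiE. Qed.

Let bar_neq0 f : f.[0] != 0 -> (bar t f).[0] != 0.
Proof. by move=> f0; rewrite bar_horner0 expf_neq0. Qed.

Lemma barK f : bar t (bar t f) = f.
Proof.
rewrite !barE; apply/polyP => i; rewrite !coef_map/= !phiE -exprM.
exact: t_inv.
Qed.

Lemma dagger_monic f : f.[0] != 0 -> dagger t f \is monic.
Proof. by move=> f0; rewrite /dagger star_monic ?bar_neq0. Qed.

Lemma dagger_horner0 f : f \is monic -> (dagger t f).[0] = (f.[0] ^+ t)^-1.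
Proof. by move=> mf; rewrite /dagger star_horner0 ?bar_monic// bar_horner0. Qed.

Lemma dagger_neq0 f : f \is monic -> f.[0] != 0 -> (dagger t f).[0] != 0.
Proof. by move=> mf f0; rewrite dagger_horner0// invr_eq0 expf_neq0. Qed.

Lemma daggerK f : f \is monic -> f.[0] != 0 -> dagger t (dagger t f) = f.
Proof. by move=> mf f0; rewrite /dagger {1}barE -star_map -barE barK starK. Qed.

Lemma daggerM f g :
  f.[0] != 0 -> g.[0] != 0 -> dagger t (f * g) = dagger t f * dagger t g.
Proof.
move=> f0 g0; rewrite /dagger -starM ?bar_neq0//; congr star.
by rewrite !barE rmorphM.
Qed.

Lemma size_dagger f : f.[0] != 0 -> size (dagger t f) = size f.
Proof. by move=> f0; rewrite size_star ?bar_neq0// barE size_map_poly. Qed.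

Lemma deg_mul_dagger g : g \is monic -> g.[0] != 0 ->
  deg (g * dagger t g) = (deg g).*2.
Proof.
move=> mg g0; have d0 := monic_neq0 (dagger_monic g0).
rewrite /deg size_monicM// size_dagger//.
move: (monic_neq0 mg); rewrite -size_poly_gt0.
by case: (size g) => [//|k] _; rewrite addnS /= addnn.
Qed.

Lemma dvdp_horner_neq0 f g : g %| f -> f.[0] != 0 -> g.[0] != 0.
Proof. by move=> /dvdpP[u ->]; rewrite hornerM mulf_eq0 negb_or => /andP[]. Qed.

Lemma dvdp_dagger f g : f.[0] != 0 -> g %| f -> dagger t g %| dagger t f.
Proof.
move=> f0 gf; have g0 := dvdp_horner_neq0 gf f0.
have uf : f %/ g %| f by rewrite -[X in _ %| X](divpK gf) dvdp_mulr.
rewrite -[X in _ %| dagger t X](divpK gf) daggerM ?dvdp_mull//.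
exact: dvdp_horner_neq0 uf f0.
Qed.

(** The gcd of two symmetric polynomials is symmetric because [dagger] maps it
    to a common divisor of the same degree. *)
Lemma dagger_class : factorization_class (dagger_symmetric F t).
Proof.
split=> [f [] //|f g|f g|f g].
- move=> [mf f0 fE] [mg g0 gE]; split; first by rewrite monicMl.
    by rewrite hornerM mulf_neq0.
  by rewrite daggerM// fE gE.
- move=> [mf f0 fE] [mfg fg0 fgE].
  have g0 : g.[0] != 0 by apply: dvdp_horner_neq0 fg0; rewrite dvdp_mull.
  split=> //; first by rewrite -(monicMl _ mf).
  have : f * dagger t g = f * g by rewrite -[in RHS]fgE daggerM// fE.
  by apply: mulfI; rewrite monic_neq0.
- move=> [mf f0 fE] [mg g0 gE].
  have d0 : gcdp f g != 0 by rewrite gcdp_eq0 (negPf (monic_neq0 mf)).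
  have l0 : (lead_coef (gcdp f g))^-1 != 0 by rewrite invr_eq0 lead_coef_eq0.
  pose h := (lead_coef (gcdp f g))^-1 *: gcdp f g.
  have hE : h %= gcdp f g by rewrite /h eqp_scale.
  have mh : h \is monic by rewrite monicE lead_coefZ mulVf// lead_coef_eq0.
  have hf : h %| f by rewrite (eqp_dvdl _ hE) dvdp_gcdl.
  have hg : h %| g by rewrite (eqp_dvdl _ hE) dvdp_gcdr.
  have h0 := dvdp_horner_neq0 hf f0.
  exists h => //; split=> //.
  apply: monic_dvdp_eq => //; first exact: dagger_monic.
    rewrite (eqp_dvdr _ hE) dvdp_gcd -{1}fE -gE.
    by rewrite !dvdp_dagger.
  by rewrite /deg size_dagger.
Qed.

End Dagger.

Lemma monic_class (F : fieldType) :
  factorization_class [set f : {poly F} | f \is monic].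
Proof.
split=> //= f g mf; [by rewrite monicMl|by rewrite monicMl|move=> mg].
have d0 : gcdp f g != 0 by rewrite gcdp_eq0 (negPf (monic_neq0 mf)).
exists ((lead_coef (gcdp f g))^-1 *: gcdp f g).
  by rewrite monicE lead_coefZ mulVf// lead_coef_eq0.
by rewrite eqp_scale// invr_eq0 lead_coef_eq0.
Qed.

Lemma irreducible_in_monic (F : fieldType) (f : {poly F}) :
  irreducible_in [set f : {poly F} | f \is monic] f <->
  f \is monic /\ irreducible_poly f.
Proof.
have sdeg g : (0 < deg g)%N = (1 < size g)%N :> bool.
  by rewrite /deg; case: (size g).
split=> [[/= mf f0 minf]|[mf [f1 irrf]]].
  split=> //; split=> [|q q1 qf]; first by rewrite -sdeg.
  have q0 : q != 0.
    apply: contraTneq qf => ->.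
    by rewrite dvd0p monic_neq0.
  have l0 : (lead_coef q)^-1 != 0 by rewrite invr_eq0 lead_coef_eq0.
  have e : (lead_coef q)^-1 *: q %= q by rewrite eqp_scale.
  rewrite -(minf ((lead_coef q)^-1 *: q)) ?(eqp_dvdl _ e)//=.
  - by rewrite eqp_sym.
  - by rewrite monicE lead_coefZ mulVf// lead_coef_eq0.
  rewrite sdeg size_scale//.
  by move: q1 q0; rewrite -size_poly_gt0; case: (size q) => [|[]].
split=> //; first by rewrite sdeg.
move=> g mg; rewrite sdeg => g1 gf; apply/eqP.
by rewrite -eqp_monic// irrf// gtn_eqF.
Qed.

(** The irreducible divisors of a symmetric [f] are permuted by [dagger]:
    a fixed one is a symmetric divisor by itself, and one which moves is coprime
    to its image, so that the product of the two is a symmetric divisor. *)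
Lemma irreducible_in_daggerP (F : fieldType) (t : nat) (f : {poly F}) :
  [pchar F].-nat t -> (forall x : F, x ^+ (t ^ 2) = x) ->
  irreducible_in (dagger_symmetric F t) f ->
  irreducible_poly f \/
  exists g : {poly F}, [/\ g \is monic, g.[0] != 0, irreducible_poly g,
    irreducible_poly (dagger t g) & coprimep g (dagger t g)] /\
    f = g * dagger t g.
Proof.
move=> tc ti [Sf f0' minf]; have [mf f0 fE] := Sf.
have [g ig gf] := irreducible_in_divisor (@monic_class F) mf f0'.
have [mg irg] := (irreducible_in_monic g).1 ig.
have g0 := dvdp_horner_neq0 gf f0.
have dg : (0 < deg g)%N by case: ig.
have [gE|gne] := eqVneq (dagger t g) g.
  by left; rewrite -(minf g).
right; exists g.
have dgf : dagger t g %| f by rewrite -fE dvdp_dagger.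
have md := @dagger_monic _ _ tc g g0.
have d0 := @dagger_neq0 _ _ tc g mg g0.
have sdeg (u : {poly F}) : u.[0] != 0 -> deg (dagger t u) = deg u.
  by move=> u0; rewrite /deg (size_dagger tc u0).
have idg : irreducible_in [set f : {poly F} | f \is monic] (dagger t g).
  split; [exact: md|by rewrite sdeg|].
  move=> h mh h0 hd.
  have hz := dvdp_horner_neq0 hd d0.
  case: ig => _ _ /(_ (dagger t h)) e.
  rewrite -[h](@daggerK _ _ tc ti)// e//=.
  - exact: dagger_monic.
  - by rewrite sdeg.
  by rewrite -[g](@daggerK _ _ tc ti)// dvdp_dagger.
have cop : coprimep g (dagger t g).
  by apply: (irreducible_in_coprime (@monic_class F)) => //; rewrite eq_sym.
split; first by split=> //; case: ((irreducible_in_monic _).1 idg).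
rewrite -(minf (g * dagger t g))//.
- split; first by rewrite monicMl.
    by rewrite hornerM mulf_neq0.
  by rewrite daggerM// daggerK// mulrC.
- by rewrite deg_mul_dagger// double_gt0.
by rewrite Gauss_dvdp// gf.
Qed.

(** * Roots of irreducible polynomials over a finite field *)

Lemma expf_card_exp (F : finFieldType) (i : nat) (x : F) : x ^+ (#|F| ^ i) = x.
Proof. by elim: i => [|i IH]; rewrite ?expr1// expnS exprM expf_card. Qed.

Lemma bar_card (F : finFieldType) (i : nat) (f : {poly F}) :
  bar (#|F| ^ i) f = f.
Proof. by apply/polyP => j; rewrite coef_map_id0 ?expf_card_exp. Qed.

(** Frobenius moves evaluation at [z] to evaluation at [z ^ t], at the price of
    applying it to the coefficients. *)
Lemma horner_bar (F L : fieldType) (iota : {rmorphism F -> L}) (t : nat)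
    (f : {poly F}) (z : L) :
  [pchar F].-nat t ->
  (map_poly iota f).[z] ^+ t = (map_poly iota (bar t f)).[z ^+ t].
Proof.
move=> tc; have t0 : t != 0%N by case: (t) tc.
have tL : [pchar L].-nat t by rewrite (eq_pnat _ (fmorph_pchar iota)).
have [phi phiE] := frobenius_rmorphism tL.
have -> : map_poly iota (bar t f) = map_poly phi (map_poly iota f).
  apply/polyP => i; rewrite !coef_map/= phiE -rmorphXn/= coef_map_id0//.
  by rewrite expr0n (negPf t0).
by rewrite -!phiE horner_map.
Qed.

Lemma card_pchar_nat (F : finFieldType) (i : nat) : [pchar F].-nat (#|F| ^ i)%N.
Proof.
have [p pp pF] := finPcharP F.
have qk : #|F| = (p ^ logn p #|F|)%N := card_pprimeChar pF.
rewrite pnatX; apply/orP; left.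
by rewrite qk pnatX (eq_pnat _ (pcharf_eq pF)) pnat_id.
Qed.

Lemma expf_inj (L : fieldType) (t : nat) :
  [pchar L].-nat t -> injective (fun x : L => x ^+ t).
Proof.
move=> tc x y xy; have [phi phiE] := frobenius_rmorphism tc.
by apply: (fmorph_inj phi); rewrite !phiE.
Qed.

Lemma card_finvect (F : finFieldType) (L : fieldExtType F) :
  #|finvect_type L| = (#|F| ^ \dim {:L})%N.
Proof.
rewrite -(@card_vspace F (finvect_type L) (Vector.class L)).
by rewrite (@card_vspacef F (finvect_type L) (Vector.class L)).
Qed.

(** The conjugates of a root [z] are its iterated [q]-th powers: [d] of them are
    distinct because [z] generates an extension with [q ^ d] elements. *)
Lemma irreducible_conjugates (F : finFieldType) (f : {poly F}) :
  f \is monic -> irreducible_poly f ->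
  exists (L : fieldType) (iota : {rmorphism F -> L}) (z : L),
    [/\ map_poly iota f = \prod_(i < deg f) ('X - (z ^+ (#|F| ^ i))%:P),
        z ^+ (#|F| ^ deg f) = z &
        forall m, z ^+ (#|F| ^ m) = z -> (deg f %| m)%N].
Proof.
move=> mf irf; have [L dimL [z fz zgen]] := irredp_FAdjoin irf.
pose emb : {rmorphism F -> L} := GRing.in_alg L.
set q := #|F|; set d := deg f.
have cardL (x : L) : x ^+ (q ^ d) = x.
  have := @expf_card (finvect_type L) x.
  by rewrite card_finvect dimL.
have qL i : [pchar L].-nat (q ^ i)%N.
  by rewrite (eq_pnat _ (fmorph_pchar emb)) card_pchar_nat.
have d0 : (0 < d)%N.
  by case: irf; rewrite /d /deg; case: (size f) => [//|[//|k]].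
(* Otherwise some [k < d] has [z ^ (q ^ k) = z]; then all [q ^ d] elements of
   [L = F(z)] are roots of [X ^ (q ^ k) - X]. *)
have perz m : z ^+ (q ^ m) = z -> (d %| m)%N.
  move=> zm; set k := (m %% d)%N.
  have zk : z ^+ (q ^ k) = z.
    have e j : z ^+ (q ^ (j * d + k)) = z ^+ (q ^ k).
      rewrite expnD exprM mulnC expnM.
      by elim: j => [|j IH]; rewrite ?expr1// expnSr exprM cardL IH.
    by rewrite -(e (m %/ d)%N) -divn_eq.
  have [k0|k0] := posnP k; first by rewrite /dvdn -/k k0.
  have fixL (x : L) : x ^+ (q ^ k) = x.
    have : x \in <<1; z>>%VS by rewrite zgen memvf.
    move=> /Fadjoin_polyP[u /polyOver1P[v ->] ->].
    by rewrite (horner_bar emb) ?card_pchar_nat// bar_card zk.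
  have kd : (k < d)%N by rewrite ltn_mod.
  have q1 : (1 < q)%N by apply: finNzRing_gt1.
  have : (#|finvect_type L| <= q ^ k)%N.
    pose G : {poly finvect_type L} := 'X^(q ^ k) - 'X.
    have sG : size G = (q ^ k).+1.
      rewrite size_polyDl ?size_polyXn// size_polyN size_polyX ltnS.
      by have : (q ^ 0 < q ^ k)%N by rewrite ltn_exp2l.
    have G0 : G != 0 by rewrite -size_poly_gt0 sG.
    rewrite cardE -ltnS -sG; apply: max_poly_roots => //; last exact: enum_uniq.
    apply/allP => x _; rewrite /root hornerD hornerN hornerXn hornerX subr_eq0.
    by apply/eqP; exact: fixL.
  by rewrite card_finvect dimL leq_exp2l// leqNgt kd.
exists L, emb, z; split=> //.
have zroot i : root (map_poly emb f) (z ^+ (q ^ i)).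
  apply/rootP; rewrite -(bar_card i f) -horner_bar ?card_pchar_nat//.
  by rewrite (rootP fz) expr0n expn_eq0 gtn_eqF// (ltnW (finNzRing_gt1 F)).
pose rs := [seq z ^+ (q ^ i) | i <- index_iota 0 d].
have srs : size rs = d by rewrite size_map size_iota subn0.
have wlog_inj i j : (i <= j < d)%N -> z ^+ (q ^ i) = z ^+ (q ^ j) -> i = j.
  move=> /andP[ij jd] e.
  have /perz : z ^+ (q ^ (j - i)) = z.
    apply: (expf_inj (qL i)); rewrite /= -exprM -expnD subnK//.
  have [/eqP|ij0] := posnP (j - i)%N.
    by rewrite subn_eq0 => ji _; apply/eqP; rewrite eqn_leq ij ji.
  move=> /(dvdn_leq ij0); rewrite leqNgt => /negP[].
  exact: leq_ltn_trans (leq_subr _ _) jd.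
have urs : uniq rs.
  rewrite map_inj_in_uniq ?iota_uniq// => i j.
  rewrite !mem_index_iota /= => id jd e.
  have [ij|/ltnW ji] := leqP i j; first by apply: wlog_inj; rewrite ?ij.
  by apply/esym/wlog_inj; rewrite ?ji.
have -> := @all_roots_prod_XsubC _ (map_poly emb f) rs.
- by rewrite lead_coef_map (monicP mf) rmorph1 scale1r big_map big_mkord.
- rewrite srs size_map_poly /d /deg.
  by move: d0; rewrite /d /deg; case: (size f).
- by apply/allP => y /mapP[i _ ->].
by rewrite uniq_rootsE.
Qed.

Lemma irreducible_deg (F : fieldType) (f : {poly F}) :
  irreducible_poly f -> (0 < deg f)%N.
Proof. by case; rewrite /deg; case: (size f) => [//|[//|k]]. Qed.

Lemma irreducible_root (F : finFieldType) (f : {poly F}) :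
  f \is monic -> irreducible_poly f ->
  exists (L : fieldType) (emb : {rmorphism F -> L}) (z : L),
    [/\ root (map_poly emb f) z,
        forall y, root (map_poly emb f) y ->
          exists2 i, (i < deg f)%N & y = z ^+ (#|F| ^ i),
        z ^+ (#|F| ^ deg f) = z,
        forall m, z ^+ (#|F| ^ m) = z -> (deg f %| m)%N &
        z ^+ (\sum_(i < deg f) #|F| ^ i) = emb ((-1) ^+ deg f * f.[0])].
Proof.
move=> mf irf; have [L [emb [z [fE zd perz]]]] := irreducible_conjugates mf irf.
have rP y : root (map_poly emb f) y ->
    exists2 i, (i < deg f)%N & y = z ^+ (#|F| ^ i).
  rewrite fE /root horner_prod => /prodf_eq0[i _].
  by rewrite hornerXsubC subr_eq0 => /eqP->; exists i.
exists L, emb, z; split=> //.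
  rewrite fE /root horner_prod (bigD1 (Ordinal (irreducible_deg irf)))//=.
  by rewrite expn0 expr1 hornerXsubC subrr mul0r.
have : emb f.[0] = \prod_(i < deg f) (- z ^+ (#|F| ^ i)).
  rewrite -horner_map rmorph0 fE horner_prod; apply: eq_bigr => i _.
  by rewrite hornerXsubC sub0r.
rewrite prodrN card_ord rmorphM rmorphXn rmorphN rmorph1 => ->.
rewrite mulrA -expr2 sqrr_sign mul1r.
by elim/big_rec2: _ => [|i y u _ <-]; rewrite ?expr0// exprD.
Qed.

Lemma irreducible_dvdp (F L : fieldType) (emb : {rmorphism F -> L})
    (f G : {poly F}) (z : L) :
  irreducible_poly f -> root (map_poly emb f) z -> root (map_poly emb G) z ->
  f %| G.
Proof.
move=> irf fz Gz; apply/negPn; rewrite -(irreducible_poly_coprime G irf).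
rewrite -(coprimep_map emb); apply/negP => /coprimep_root/(_ fz).
by move/rootP: Gz => ->; rewrite eqxx.
Qed.

Lemma root_XnsubC (F L : fieldType) (emb : {rmorphism F -> L}) n c (z : L) :
  z ^+ n = emb c -> root (map_poly emb ('X^n - c%:P)) z.
Proof.
move=> zn; rewrite rmorphB/= map_polyXn map_polyC/= /root.
by rewrite hornerD hornerN hornerXn hornerC zn subrr.
Qed.

Lemma root_neq0 (F L : fieldType) (emb : {rmorphism F -> L})
    (f : {poly F}) (z : L) :
  f.[0] != 0 -> root (map_poly emb f) z -> z != 0.
Proof.
move=> f0; apply: contraTneq => ->.
by rewrite /root -{1}(rmorph0 emb) horner_map fmorph_eq0.
Qed.

Lemma irreducible_dvd_XnsubX (F : finFieldType) (f : {poly F}) :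
  f \is monic -> irreducible_poly f -> f %| 'X^(#|F| ^ deg f) - 'X.
Proof.
move=> mf irf; have [L [emb [z [fz _ zd _ _]]]] := irreducible_root mf irf.
apply: (irreducible_dvdp irf fz); rewrite rmorphB/= map_polyXn map_polyX /root.
by rewrite hornerD hornerN hornerXn hornerX zd subrr.
Qed.

Lemma irreducible_dvd_unity (F : finFieldType) (f : {poly F}) :
  f \is monic -> irreducible_poly f -> f.[0] != 0 ->
  f %| 'X^(#|F| ^ deg f - 1) - 1.
Proof.
move=> mf irf f0; have [L [emb [z [fz _ zd _ _]]]] := irreducible_root mf irf.
apply: (irreducible_dvdp irf fz); rewrite -[1]/(1%:P); apply: root_XnsubC.
apply: (mulIf (root_neq0 f0 fz)).
rewrite -exprSr subn1 prednK ?zd ?rmorph1 ?mul1r//.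
by rewrite expn_gt0 (ltnW (finNzRing_gt1 F)).
Qed.

(** The constant term is, up to sign, the norm of a root, which is the power
    of the root with exponent [(q ^ d - 1) / (q - 1)]. *)
Lemma irreducible_dvd_norm (F : finFieldType) (f : {poly F}) (k : nat) :
  f \is monic -> irreducible_poly f ->
  f %| 'X^(\sum_(i < deg f) #|F| ^ i * k) - (((-1) ^+ deg f * f.[0]) ^+ k)%:P.
Proof.
move=> mf irf; have [L [emb [z [fz _ _ _ zN]]]] := irreducible_root mf irf.
apply: (irreducible_dvdp irf fz); apply: root_XnsubC.
by rewrite -big_distrl/= exprM zN rmorphXn.
Qed.

(** For symmetric [f], the roots of [bar t f] are the inverses of those of [f],
    and applying Frobenius to such a root undoes [bar t]. *)
Lemma symmetric_root (F L : fieldType) (emb : {rmorphism F -> L}) (t : nat)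
    (f : {poly F}) (z : L) :
  [pchar F].-nat t -> (forall x : F, x ^+ (t ^ 2) = x) ->
  dagger_symmetric F t f -> root (map_poly emb f) z ->
  root (map_poly emb f) (z^-1 ^+ t).
Proof.
move=> tc ti [mf f0 fE] fz; have z0 := root_neq0 f0 fz.
have t0 : t != 0%N by case: (t) tc.
have : (map_poly emb (bar t f)).[z^-1] = 0.
  move/rootP: fz; rewrite -{1}fE /dagger starE map_polyZ hornerZ.
  rewrite horner_rev_poly// => /eqP; rewrite !mulf_eq0 fmorph_eq0 invr_eq0.
  rewrite bar_horner0// expf_eq0 (negPf f0) andbF expf_eq0 (negPf z0) andbF/=.
  by move/eqP.
move=> h; apply/rootP; rewrite -[f in map_poly _ f](barK tc ti) -horner_bar//.
by rewrite h expr0n (negPf t0).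
Qed.

(** Inversion maps a root [z] to a conjugate [z ^ (q ^ i)] with [i < d].  Being
    an involution, it forces [d] to divide [2 i], so that [i = 0] and
    [z = 1] or [z = -1], or else [d = 2 i] and [z ^ (q ^ i + 1) = 1]. *)
Lemma star_irreducible_cases (F : finFieldType) (f : {poly F}) :
  irreducible_poly f -> dagger_symmetric F 1 f ->
  (deg f = 1%N /\ f %| 'X^2 - 1) \/
  exists2 j, deg f = j.*2 & f %| 'X^(#|F| ^ j + 1) - 1.
Proof.
move=> irf Sf; have [mf f0 _] := Sf.
have [L [emb [z [fz conj zd perz _]]]] := irreducible_root mf irf.
have z0 := root_neq0 f0 fz.
have c1 : [pchar F].-nat 1%N by [].
have [i id] := conj _ (symmetric_root c1 (fun x => expr1 x) Sf fz).
rewrite expr1 => zi.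
have dv2 : (deg f %| i.*2)%N.
  by apply: perz; rewrite -addnn expnD exprM -zi exprVn -zi invrK.
have [i0|i0] := posnP i.
  have z2 : z ^+ 2 = emb 1.
    by rewrite expr2 rmorph1 -{2}[z]invrK zi i0 expn0 expr1 divff.
  left; split; last first.
    apply: (irreducible_dvdp irf fz).
    by rewrite -[1]/(1%:P); apply: root_XnsubC.
  apply/eqP; rewrite -dvdn1; apply: perz; rewrite expn1.
  have /eqP : (z - emb 1) * (z + emb 1) = 0.
    by rewrite -subr_sqr z2 rmorph1 expr1n subrr.
  rewrite mulf_eq0 subr_eq0 addr_eq0 => /orP[] /eqP ->.
    by rewrite -rmorphXn/= expr1n.
  by rewrite -rmorphN -rmorphXn/= expf_card.
right; exists i.
  have [k dk] := dvdnP dv2; move: dk id i0; rewrite -!muln2.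
  by case: k => [|[|k]]; nia.
apply: (irreducible_dvdp irf fz); rewrite -[1]/(1%:P); apply: root_XnsubC.
by rewrite exprD expr1 -zi mulVf// rmorph1.
Qed.

(** Here [z ^ (- s)] is a conjugate [z ^ (q ^ i)] with [i < d], and applying this
    map twice gives [z ^ q]; hence [2 i] is [1] modulo [d].  So [d] is odd and,
    writing [q = s ^ 2], [z ^ (- s) = z ^ (s ^ (d + 1))]. *)
Lemma dagger_irreducible_root (F : finFieldType) (s : nat) (f : {poly F}) :
  #|F| = (s ^ 2)%N -> [pchar F].-nat s ->
  irreducible_poly f -> dagger_symmetric F s f ->
  exists (L : fieldType) (emb : {rmorphism F -> L}) (z : L),
    [/\ root (map_poly emb f) z, odd (deg f), z ^+ (s ^ deg f + 1) = 1 &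
        z ^+ (\sum_(i < deg f) #|F| ^ i) = emb ((-1) ^+ deg f * f.[0])].
Proof.
move=> qs sc irf Sf; have [mf f0 _] := Sf.
have [L [emb [z [fz conj zd perz zN]]]] := irreducible_root mf irf.
have z0 := root_neq0 f0 fz.
have ti (x : F) : x ^+ (s ^ 2) = x by rewrite -qs expf_card.
have sL k : [pchar L].-nat (s ^ k)%N.
  by rewrite (eq_pnat _ (fmorph_pchar emb)) pnatX sc.
have [i id zi] := conj _ (symmetric_root sc ti Sf fz).
have e : z ^+ #|F| = z ^+ (#|F| ^ i.*2).
  rewrite -addnn expnD exprM -zi -exprM mulnC exprM [z^-1 ^+ _]exprVn -zi.
  by rewrite -exprVn invrK -exprM qs expnS expn1.
have dE : deg f = (i.*2 - 1)%N /\ (0 < i)%N \/ deg f = 1%N /\ i = 0%N.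
  have [i0|i0] := posnP i.
    right; split=> //; apply/eqP; rewrite -dvdn1; apply: perz.
    by rewrite expn1 e i0 expr1.
  left; split=> //.
  have : (deg f %| i.*2 - 1)%N.
    apply: perz; have sL1 := sL 2; rewrite -qs in sL1.
    apply: (expf_inj sL1); rewrite /= -exprM -expnSr e; congr (_ ^+ (_ ^ _)).
    by move: i0; rewrite -muln2; lia.
  by move=> /dvdnP[k]; move: id i0; rewrite -!muln2; case: k => [|[|k]]; nia.
have od : odd (deg f).
  case: dE => [[-> i0]|[-> //]].
  by rewrite -[i]prednK// doubleS subn1 /= odd_double.
have zs : z^-1 = z ^+ (s ^ deg f).
  apply: (expf_inj (sL 1)); rewrite /= expn1 zi -exprM -expnSr qs -expnM.
  case: dE => [[-> i0]|[d1 ->]]; last first.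
    by rewrite muln0 expn0 expr1 d1 -qs -[in LHS]zd d1 expn1.
  by congr (_ ^+ (_ ^ _)); move: i0; rewrite -muln2; lia.
exists L, emb, z; split=> //.
by rewrite exprD expr1 -zs mulVf.
Qed.

(** * Counting relative irreducibles of a given degree *)

Lemma deg_XnsubC (F : fieldType) (n : nat) (c : F) :
  (0 < n)%N -> deg ('X^n - c%:P) = n.
Proof. by move=> n0; rewrite /deg size_XnsubC. Qed.

Lemma XnsubC_neq0 (F : fieldType) (n : nat) (c : F) :
  (0 < n)%N -> 'X^n - c%:P != 0.
Proof. by move=> n0; rewrite -size_poly_gt0 size_XnsubC. Qed.

Lemma irreducible_count (F : finFieldType) (s : seq {poly F}) (e : nat) :
  uniq s ->
  {in s, forall p, irreducible_in [set f : {poly F} | f \is monic] p /\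
    deg p = e} ->
  (e * size s <= #|F| ^ e)%N.
Proof.
move=> us sP; have q1 : (1 < #|F|)%N := finNzRing_gt1 F.
have [->|e0] := posnP e; first by rewrite mul0n.
have sG : size ('X^(#|F| ^ e) - 'X : {poly F}) = (#|F| ^ e).+1.
  rewrite size_polyDl ?size_polyXn// size_polyN size_polyX ltnS.
  by have : (#|F| ^ 0 < #|F| ^ e)%N by rewrite ltn_exp2l.
have -> : (#|F| ^ e)%N = deg ('X^(#|F| ^ e) - 'X : {poly F}) by rewrite /deg sG.
apply: (irreducible_in_count (@monic_class F)) => //.
  by rewrite -size_poly_gt0 sG.
move=> p /sP[ip dp]; split=> //.
have [mp irp] := (irreducible_in_monic p).1 ip.
by rewrite -dp irreducible_dvd_XnsubX.
Qed.

(** The irreducibles with constant term [b] all divide the binomial which says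
    that the norm of a root is [b] up to sign. *)
Lemma irreducible_const_count (F : finFieldType) (s : seq {poly F}) (e : nat)
    (b : F) :
  uniq s ->
  {in s, forall p, [/\ irreducible_in [set f : {poly F} | f \is monic] p,
    deg p = e & p.[0] = b]} ->
  (e * size s <= 2 * #|F| ^ e.-1)%N.
Proof.
move=> us sP; have q1 : (1 < #|F|)%N := finNzRing_gt1 F.
have [->|e0] := posnP e; first by rewrite mul0n.
set N := (\sum_(i < e) #|F| ^ i * 1)%N.
have N0 : (0 < N)%N.
  by rewrite /N (bigD1 (Ordinal e0))//= expn0.
apply: (@leq_trans N).
  rewrite -(deg_XnsubC (((-1) ^+ e * b) ^+ 1) N0).
  apply: (irreducible_in_count (@monic_class F)) => //.
    exact: XnsubC_neq0.
  move=> p /sP[ip dp pb]; split=> //.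
  have [mp irp] := (irreducible_in_monic p).1 ip.
  by have := irreducible_dvd_norm 1 mp irp; rewrite dp pb.
have : ((#|F|).-1 * N = (#|F| ^ e).-1)%N.
  rewrite predn_exp /N; congr (_ * _)%N.
  by apply: eq_bigr => i _; rewrite muln1.
case: (e) e0 => // k _; rewrite expnS /=.
move: q1 (expn_gt0 #|F| k); case: #|F| => [//|[//|u]] _ /= /esym; nia.
Qed.

(** A symmetric irreducible of odd degree has a root equal to [1] or [-1]. *)
Lemma star_odd_count (F : finFieldType) (s : seq {poly F}) (e : nat) :
  uniq s -> odd e ->
  {in s, forall p, irreducible_in (dagger_symmetric F 1) p /\ deg p = e} ->
  (size s <= if e == 1 then 2 else 0)%N.
Proof.
have c1 : [pchar F].-nat 1%N by [].
have cls := dagger_class c1.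
move=> us oe sP.
have key p : p \in s -> e = 1%N /\ p %| 'X^2 - 1.
  move=> /sP[ip dp].
  have [irp|[g [[mg g0 irg _ _] pE]]] :=
      irreducible_in_daggerP c1 (fun x : F => expr1 x) ip.
    have Sp : dagger_symmetric F 1 p by case: ip.
    have [[d1 dv]|[j dj _]] := star_irreducible_cases irp Sp.
      by rewrite -dp.
    by move: oe; rewrite -dp dj odd_double.
  by move: oe; rewrite -dp pE deg_mul_dagger// odd_double.
have [e1|ne1] := eqVneq e 1%N; last first.
  case: s us key {sP} => // p s _ /(_ p (mem_head _ _)) [e1].
  by rewrite e1 eqxx in ne1.
have dG : deg ('X^2 - 1 : {poly F}) = 2%N by rewrite -[1]/(1%:P) deg_XnsubC.
have := @irreducible_in_count F _ cls s ('X^2 - 1) 1 us.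
rewrite mul1n dG; apply; first by rewrite -[1]/(1%:P) XnsubC_neq0.
by move=> p ps; have [ip dp] := sP p ps; have [_ dv] := key p ps; rewrite dp e1.
Qed.

(** In degree [2 j], the irreducible ones divide [X ^ (q ^ j + 1) - 1] and the
    pairs [g * dagger 1 g] divide [X ^ (q ^ j - 1) - 1]. The exact leading
    constant [q ^ j / j] matters, since it is exponentiated in the end. *)
Lemma star_even_count (F : finFieldType) (s : seq {poly F}) (j : nat) :
  uniq s ->
  {in s, forall p, irreducible_in (dagger_symmetric F 1) p /\ deg p = j.*2} ->
  (j * size s <= #|F| ^ j)%N.
Proof.
have c1 : [pchar F].-nat 1%N by [].
have cls := dagger_class c1.
move=> us sP; have q1 : (1 < #|F|)%N := finNzRing_gt1 F.
have [->|j0] := posnP j; first by rewrite mul0n.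
have qj : (1 < #|F| ^ j)%N.
  by have : (#|F| ^ 0 < #|F| ^ j)%N by rewrite ltn_exp2l.
pose G1 : {poly F} := 'X^(#|F| ^ j + 1) - 1%:P.
pose G2 : {poly F} := 'X^(#|F| ^ j - 1) - 1%:P.
have s1 : size G1 = (#|F| ^ j + 1).+1 by rewrite size_XnsubC// addn1.
have s2 : size G2 = (#|F| ^ j - 1).+1 by rewrite size_XnsubC// subn_gt0.
have n1 : G1 != 0 by rewrite -size_poly_gt0 s1.
have n2 : G2 != 0 by rewrite -size_poly_gt0 s2.
have dG : deg (G1 * G2) = (#|F| ^ j).*2.
  by rewrite /deg size_mul// s1 s2 -muln2; move: qj; clear; lia.
have := @irreducible_in_count F _ cls s (G1 * G2) j.*2 us.
rewrite dG -doubleMl leq_double; apply; first by rewrite mulf_neq0.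
move=> p /sP[ip dp]; split=> //.
have [irp|[g [[mg g0 irg irdg cop] pE]]] :=
    irreducible_in_daggerP c1 (fun x : F => expr1 x) ip.
  have Sp : dagger_symmetric F 1 p by case: ip.
  have [[d1 _]|[k dk dv]] := star_irreducible_cases irp Sp.
    by have := odd_double j; rewrite -dp d1.
  by move: dp; rewrite dk => /double_inj kj; rewrite dvdp_mulr// /G1 -kj.
have dg : deg g = j by apply: double_inj; rewrite -dp pE deg_mul_dagger.
rewrite pE Gauss_dvdp//; apply/andP; split; apply: dvdp_mull.
  by have := irreducible_dvd_unity mg irg g0; rewrite dg.
have := irreducible_dvd_unity (dagger_monic c1 g0) irdg (dagger_neq0 c1 mg g0).
by rewrite /deg size_dagger// -/(deg g) dg.
Qed.

(** For odd [d] the exponent [(s ^ (2 d) - 1) / (s ^ 2 - 1)] of the norm is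
    [K = (s ^ d + 1) / (s + 1)] times a number which is [1] modulo [s + 1]. *)
Lemma norm_exponent_odd (s d : nat) : (1 < s)%N -> odd d ->
  exists K M : nat, (K * (s + 1) = s ^ d + 1)%N /\
    (K * (1 + (s + 1) * M) = \sum_(i < d) (s ^ 2) ^ i)%N.
Proof.
case: s => [//|[//|u]] _ od.
have [M h] : exists M, (u.+1 * u.+3 * M + u.+2 = u.+2 ^ d)%N.
  rewrite -[d]odd_double_half od add1n; elim: (d./2) => [|j [M IH]].
    by exists 0%N; rewrite muln0 add0n expn1.
  exists (M + u.+2 ^ j.*2.+1)%N.
  rewrite doubleS [in RHS]expnS [in RHS]expnS mulnDr addnAC IH.
  by move: (u.+2 ^ _)%N => B; lia.
exists (1 + u.+1 * M)%N, M; split; first by rewrite -h; lia.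
have := predn_exp (u.+2 ^ 2) d.
set N := (\sum_(i < d) _)%N.
(* [(s ^ 2) ^ d - 1] factors as [(s ^ d - 1) (s ^ d + 1)]; cancel [s ^ 2 - 1]. *)
have -> : ((u.+2 ^ 2) ^ d = (u.+2 ^ d) * (u.+2 ^ d))%N.
  by rewrite -expnM mulnC expnM -mulnn.
rewrite -h => e; apply/eqP.
rewrite -(eqn_pmul2l (m := (u.+1 * u.+3)%N))//; apply/eqP.
have -> : (u.+1 * u.+3 = (u.+2 ^ 2).-1)%N by rewrite -mulnn; lia.
rewrite -e -mulnn; nia.
Qed.

Section DaggerCount.
Variables (F : finFieldType) (s : nat).
Hypothesis cardF : #|F| = (s ^ 2)%N.

Lemma sqrt_card_gt1 : (1 < s)%N.
Proof.
have := finNzRing_gt1 F; rewrite cardF.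
by case: (s) => [|[]].
Qed.

Lemma sqrt_card_pchar : [pchar F].-nat s.
Proof. by have := card_pchar_nat F 1; rewrite expn1 cardF pnatX orbF. Qed.

Lemma sqrt_card_inv (x : F) : x ^+ (s ^ 2) = x.
Proof. by rewrite -cardF expf_card. Qed.

Let sc := sqrt_card_pchar.
Let cls := dagger_class sc.

(** An odd degree only allows irreducibles, which divide [X ^ (s ^ e + 1) - 1];
    an even one only the pairs, which divide [X ^ (s ^ e - 1) - 1]. *)
Lemma dagger_count (l : seq {poly F}) (e : nat) :
  uniq l ->
  {in l, forall p, irreducible_in (dagger_symmetric F s) p /\ deg p = e} ->
  (e * size l <= s ^ e + 1)%N.
Proof.
move=> ul lP; have s1 := sqrt_card_gt1.
have [->|e0] := posnP e; first by rewrite mul0n.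
have se : (1 < s ^ e)%N.
  by have : (s ^ 0 < s ^ e)%N by rewrite ltn_exp2l.
pose N := if odd e then (s ^ e + 1)%N else (s ^ e - 1)%N.
have N0 : (0 < N)%N by rewrite /N; case: ifP => _; lia.
apply: (@leq_trans N); last by rewrite /N; case: ifP => _; lia.
rewrite -(deg_XnsubC (1 : F) N0).
apply: (irreducible_in_count cls) => //; first exact: XnsubC_neq0.
move=> p /lP[ip dp]; split=> //.
have [irp|[g [[mg g0 irg irdg cop] pE]]] :=
    irreducible_in_daggerP sc sqrt_card_inv ip.
  have Sp : dagger_symmetric F s p by case: ip.
  have [L [emb [z [fz od zs _]]]] := dagger_irreducible_root cardF sc irp Sp.
  apply: (irreducible_dvdp irp fz); apply: root_XnsubC.
  by rewrite /N -dp od zs rmorph1.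
have eE : e = (deg g).*2 by rewrite -dp pE deg_mul_dagger.
have NE : N = (#|F| ^ deg g - 1)%N.
  by rewrite /N eE odd_double cardF -expnM mul2n.
rewrite pE Gauss_dvdp// NE irreducible_dvd_unity//=.
have := irreducible_dvd_unity (dagger_monic sc g0) irdg (dagger_neq0 sc mg g0).
by rewrite /deg size_dagger.
Qed.

(** The constant term [c] of [g] satisfies [c ^ (s - 1) = ((g g^dagger)(0))^-1],
    so the [(s - 1)]-st power of the norm of a root of [g] is determined by
    [g * dagger s g]. *)
Lemma dagger_pair_dvd (g : {poly F}) :
  g \is monic -> g.[0] != 0 -> irreducible_poly g ->
  g %| 'X^(\sum_(i < deg g) #|F| ^ i * (s - 1)) -
       (((-1) ^+ deg g) ^+ (s - 1) * (g * dagger s g).[0]^-1)%:P.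
Proof.
move=> mg g0 irg; have s1 := sqrt_card_gt1.
have := irreducible_dvd_norm (s - 1) mg irg.
congr (_ %| _ - (_)%:P).
rewrite exprMn; congr (_ * _).
rewrite hornerM dagger_horner0 ?sqrt_card_pchar// invfM invrK.
by rewrite -{2}(subnK (ltnW s1)) exprD expr1 mulrCA mulVf// mulr1.
Qed.

(** Fixing the constant term gains a factor [s] over [dagger_count], because it
    prescribes a lower power of each root: the exponent is divided by [s + 1]. *)
Lemma dagger_const_count (l : seq {poly F}) (e : nat) (b : F) :
  uniq l ->
  {in l, forall p, [/\ irreducible_in (dagger_symmetric F s) p, deg p = e &
    p.[0] = b]} ->
  (e * size l <= s ^ e.-1)%N.
Proof.
move=> ul lP; have s1 := sqrt_card_gt1.
have [->|e0] := posnP e; first by rewrite mul0n.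
have [oe|ee] := boolP (odd e).
  have [K [M [KE KN]]] := norm_exponent_odd s1 oe.
  have K0 : (0 < K)%N by case: (K) KE => //; rewrite mul0n; lia.
  apply: (@leq_trans K); last first.
    rewrite -(leq_pmul2r (m := s + 1)) ?addn1// -addn1 KE.
    case: (e) e0 => // k _; rewrite expnSr /= mulnDr muln1 leq_add2l.
    by rewrite expn_gt0 (ltnW s1).
  rewrite -(deg_XnsubC ((-1) ^+ e * b) K0).
  apply: (irreducible_in_count cls) => //; first exact: XnsubC_neq0.
  move=> p /lP[ip dp pb]; split=> //.
  have [irp|[g [[mg g0 irg irdg cop] pE]]] :=
      irreducible_in_daggerP sc sqrt_card_inv ip.
    have Sp : dagger_symmetric F s p by case: ip.
    have [L [emb [z [fz _ zs zN]]]] := dagger_irreducible_root cardF sc irp Sp.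
    apply: (irreducible_dvdp irp fz); apply: root_XnsubC.
    move: zN; rewrite dp pb cardF -KN => <-.
    by rewrite mulnDr muln1 exprD mulnA KE -dp exprM zs expr1n mulr1.
  by move: oe; rewrite -dp pE deg_mul_dagger// odd_double.
have eE : e = e./2.*2 by rewrite -[LHS]odd_double_half (negPf ee).
set j := e./2 in eE.
have j0 : (0 < j)%N by rewrite -double_gt0 -eE.
pose N := (\sum_(i < j) #|F| ^ i * (s - 1))%N.
have N0 : (0 < N)%N.
  by rewrite /N (bigD1 (Ordinal j0))//= expn0 mul1n addn_gt0 subn_gt0 s1.
apply: (@leq_trans N); last first.
  have NE : (N * (s + 1) = (#|F| ^ j).-1)%N.
    rewrite predn_exp /N -big_distrl/= -mulnA mulnC; congr (_ * _)%N.
    by rewrite cardF -subn1 -{4}(exp1n 2) subn_sqr.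
  rewrite -(leq_pmul2r (m := s + 1)) ?addn1// -addn1 NE.
  apply: (leq_trans (leq_pred _)).
  rewrite cardF -expnM mul2n -eE mulnDr muln1 -expnSr prednK//.
  exact: leq_addr.
rewrite -(deg_XnsubC (((-1) ^+ j) ^+ (s - 1) * b^-1) N0).
apply: (irreducible_in_count cls) => //; first exact: XnsubC_neq0.
move=> p /lP[ip dp pb]; split=> //.
have [irp|[g [[mg g0 irg irdg cop] pE]]] :=
    irreducible_in_daggerP sc sqrt_card_inv ip.
  have Sp : dagger_symmetric F s p by case: ip.
  have [L [emb [z [_ od _ _]]]] := dagger_irreducible_root cardF sc irp Sp.
  by rewrite -dp od in ee.
have dg : deg g = j by apply: double_inj; rewrite -eE -dp pE deg_mul_dagger.
rewrite {1}pE Gauss_dvdp//; apply/andP; split.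
  by have := dagger_pair_dvd mg g0 irg; rewrite -pE pb dg.
have := dagger_pair_dvd (dagger_monic sc g0) (dagger_neq0 sc mg g0) irdg.
rewrite daggerK//; last exact: sqrt_card_inv.
rewrite [dagger s g * g]mulrC -pE pb.
by rewrite (_ : deg (dagger s g) = j)// -dg /deg size_dagger.
Qed.

End DaggerCount.

(** * From square-free polynomials to sets of irreducibles *)

Lemma prod_monic_deg (F : fieldType) (K : finType) (T : {set K})
    (v : K -> {poly F}) : (forall p, v p \is monic) ->
  (\prod_(p in T) v p \is monic) /\
  deg (\prod_(p in T) v p) = (\sum_(p in T) deg (v p))%N.
Proof.
move=> mv; elim/big_rec2: _ => [|p y u _ [mu du]].
  by split; [exact: monic1 | rewrite /deg size_poly1].
split; first by rewrite monicMl.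
rewrite /deg size_monicM ?monic_neq0// -[in RHS]du /deg.
move: (monic_neq0 mu) (monic_neq0 (mv p)); rewrite -!size_poly_gt0.
by case: (size u) (size (v p)) => [//|k] [//|j] _ _; rewrite addSn addnS /=.
Qed.

Lemma ncard_val (T : choiceType) (A : {fset T}) (X : set T) (D : {set A}) :
  (forall p, X p <-> exists2 q : A, q \in D & val q = p) -> ncard X = #|D|.
Proof.
move=> XD; rewrite cardE -(size_map val) /ncard; apply: perm_size.
have fX : finite_set X.
  apply: (sub_finite_set (B := [set` A])) => // p /XD[q _ <-]; exact: valP.
apply: uniq_perm => //.
  by rewrite map_inj_uniq ?enum_uniq//; exact: val_inj.
move=> p; rewrite in_fset_set//; apply/idP/mapP => [|[q qD ->]].
  by rewrite inE => /XD[q qD <-]; exists q; rewrite ?mem_enum.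
by rewrite inE; apply/XD; exists q; rewrite // -mem_enum.
Qed.

(** A square-free member of [S] is determined by its set of irreducible factors,
    whose degrees add up to its degree and whose constant terms multiply to its
    constant term.  [B] bounds the irreducibles with a given constant term and
    [rho] all those of a given degree. *)
Lemma class_count (R : realType) (F : finFieldType) (S : set {poly F})
    (n N r : nat) (I : 'I_r -> set {poly F}) (m : 'I_r -> nat) (a : F)
    (x A B : R) (rho : nat -> R) :
  factorization_class S -> 0 < x -> 0 <= B -> (0 < n)%N -> (n <= N)%N ->
  a != 0 ->
  classical_sets.partition [set: 'I_r] I
    [set p | irreducible_in S p /\ (deg p <= N)%N] ->
  (forall (l : seq {poly F}) e b, uniq l -> b != 0 ->
     {in l, forall p, [/\ irreducible_in S p, deg p = e & p.[0] = b]} ->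
     e%:R * (size l)%:R <= B * x ^+ e) ->
  (forall (l : seq {poly F}) e, uniq l ->
     {in l, forall p, irreducible_in S p /\ deg p = e} ->
     (size l)%:R / x ^+ e <= rho e) ->
  \sum_(e < N.+1) rho e <= A + \sum_(k < n) k.+1%:R^-1 ->
  (ncard (P_ a N `&` S `&` sqfree_with_factors I m))%:R
  <= expR (A + 1) * B *
     (x ^+ N * poisson_bound (fun i => \sum_(p \in I i) x ^- deg p) m).
Proof.
move=> cls x0 B0 n0 nN a0 [cov triv ne] few total harm.
set Irr := [set p | _] in cov.
have fIrr : finite_set Irr.
  by apply: sub_finite_set (finite_polys F N) => p [].
pose Kf := fset_set Irr; pose K : finType := Kf.
have KP (p : K) : Irr (val p).
  by have := valP p; rewrite in_fset_set// inE.
have KE p : Irr p -> exists q : K, val q = p.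
  move=> ip; have pK : p \in Kf by rewrite in_fset_set// inE.
  by exists (FSetSub pK).
have clex (p : K) : exists i, I i (val p).
  by have := KP p; rewrite -cov => -[i _ Ii]; exists i.
pose cl (p : K) := projT1 (cid (clex p)).
have clI (p : K) : I (cl p) (val p) by exact: (projT2 (cid (clex p))).
have clE (p : K) i : I i (val p) <-> cl p = i.
  split=> [Ii|<-//]; apply: triv => //.
  by exists (val p).
have II i p : I i p -> Irr p by move=> Ip; rewrite -cov; exists i.
have HE i : \sum_(p \in I i) x ^- deg p =
    \sum_(p : K | cl p == i) x ^- deg (val p).
  have fI : finite_set (I i) by apply: sub_finite_set fIrr; exact: II.
  rewrite fsbig_finite//; transitivity (\sum_(p <-
      [seq val q | q <- [seq q <- index_enum K | cl q == i]]) x ^- deg p).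
    2: by rewrite big_map big_filter.
  apply: perm_big; apply: uniq_perm => //.
    by rewrite map_inj_uniq ?filter_uniq ?index_enum_uniq//; exact: val_inj.
  move=> p; rewrite in_fset_set//; apply/idP/mapP => [|[q + ->]].
    rewrite inE => Ip; have [q qp] := KE p (II _ _ Ip); exists q => //.
    by rewrite mem_filter mem_index_enum andbT; apply/eqP/clE; rewrite qp.
  by rewrite mem_filter => /andP[/eqP qi _]; rewrite inE; apply/clE.
have mK (p : K) : val p \is monic.
  by have [[Sp _ _] _] := KP p; case: cls => + _ _ _; apply.
rewrite (_ : poisson_bound _ m =
  poisson_bound (fun i => \sum_(p : K | cl p == i) x ^- deg (val p)) m); last first.
  by congr poisson_bound; apply/funext => i; exact: HE.
apply: le_trans (@poisson_count R F K r cl (fun p => deg (val p))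
  (fun p => (val p).[0]) x A B n N m a x0 B0 _ _ n0 nN a0 _); first last.
- move=> i; have [p0 Ip0] := ne i Logic.I.
  have [q qp] := KE _ (II _ _ Ip0).
  have qi : cl q == i by apply/eqP/clE; rewrite qp.
  rewrite (bigD1 q)//=; apply: ltr_pwDl; first by rewrite invr_gt0 exprn_gt0.
  by apply: sumr_ge0 => p _; rewrite invr_ge0 exprn_ge0// ltW.
- apply: le_trans harm.
  rewrite (partition_big (fun p : K => inord (deg (val p)) : 'I_N.+1) predT)//=.
  apply: ler_sum => e _.
  pose l := [seq val p | p <- enum [pred p : K | inord (deg (val p)) == e]].
  have lP : {in l, forall p, irreducible_in S p /\ deg p = e}.
    move=> p /mapP[q + ->]; rewrite mem_enum inE => /eqP <-.
    by have [iq dq] := KP q; rewrite inordK.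
  have ul : uniq l by rewrite map_inj_uniq ?enum_uniq//; exact: val_inj.
  apply: le_trans (total l e ul lP); rewrite size_map -cardE.
  rewrite (eq_bigr (fun=> x ^- e)); last first.
    by move=> p /eqP <-; have [_ dp] := KP p; rewrite inordK.
  by rewrite sumr_const mulr_natl.
- move=> e b b0; set D := [set _ | _]%SET.
  rewrite cardE -(size_map val); apply: (few _ _ b) => //.
    by rewrite map_inj_uniq ?enum_uniq//; exact: val_inj.
  move=> p /mapP[q + ->]; rewrite mem_enum inE => /andP[/eqP dq /eqP cq].
  by split=> //; case: (KP q).
rewrite ler_nat; set X := _ `&` _; set Tg := [set _ | _]%SET.
pose D (f : {poly F}) : {set K} := [set p : K | val p %| f]%SET.
have XS f : X f -> [/\ S f, square_free f, deg f = N & f.[0] = a].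
  by move=> [[[_ ? ?] ?] []].
have fE f : X f -> f = \prod_(p in D f) val p.
  move=> /XS[Sf sqf df _]; rewrite -big_enum/= -(big_map val xpredT id).
  apply: (square_free_prod cls) => //.
    by rewrite map_inj_uniq ?enum_uniq//; exact: val_inj.
  move=> p; split=> [/mapP[q + ->]|[ip pf]].
    by rewrite mem_enum inE; split=> //; case: (KP q).
  have [|q qp] := KE p.
    split=> //; rewrite -df /deg; have [mf _ _ _] := cls.
    have := dvdp_leq (monic_neq0 (mf _ Sf)) pf.
    by case: (size p) (size f) => [|u] [|v].
  by apply/mapP; exists q; rewrite // mem_enum inE qp.
have fX : finite_set X.
  by apply: sub_finite_set (finite_polys F N) => f /XS[_ _ /= ->].
pose Y := fset_set X.
have YP (f : Y) : X (val f) by have := valP f; rewrite in_fset_set// inE.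
pose g (f : Y) := D (val f).
have ginj : injective g.
  move=> f1 f2 e; apply: val_inj.
  by rewrite (fE _ (YP f1)) (fE _ (YP f2)) -/(g f1) e.
rewrite /ncard -/Y cardfE -(card_imset _ ginj); apply: subset_leq_card.
apply/fintype.subsetP => T /imsetP[f _ ->]; rewrite inE.
have Xf := YP f; have [Sf sqf df f0] := XS _ Xf.
have [mp dp] := prod_monic_deg (g f) mK.
apply/and3P; split.
- apply/forallP => i; apply/eqP; case: Xf => _ [_ /(_ i) <-].
  apply/esym/ncard_val => p; split=> [[Ip pf]|[q + <-]].
    have [q qp] := KE p (II _ _ Ip); exists q => //.
    by rewrite !inE qp pf /=; apply/eqP/clE; rewrite qp.
  by rewrite !inE => /andP[? /eqP ?]; split=> //; apply/clE.
- by rewrite -dp -fE// df.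
by rewrite -horner_prod -fE// f0.
Qed.

(** * The three families *)

Lemma powR_half (R : realType) (q : R) (k : nat) : 0 <= q ->
  q `^ (k%:R / 2) = Num.sqrt q ^+ k.
Proof.
by move=> q0; rewrite mulrC powRrM powR12_sqrt// powR_mulrn// sqrtr_ge0.
Qed.

Lemma HirrE (R : realType) (F : finFieldType) (I : set {poly F}) :
  Hirr R I = \sum_(p \in I) (#|F|%:R : R) ^- deg p.
Proof. by apply: eq_fsbigr => p _; rewrite powRN powR_mulrn. Qed.

Lemma HsymE (R : realType) (F : finFieldType) (I : set {poly F}) :
  Hsym R I = \sum_(p \in I) (Num.sqrt #|F|%:R : R) ^- deg p.
Proof. by apply: eq_fsbigr => p _; rewrite powRN powR_half. Qed.

Lemma count_ratio (R : realType) (k e N : nat) (y : R) : 0 < y -> (0 < e)%N ->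
  (e * k <= N)%N -> k%:R / y <= N%:R / y / e%:R.
Proof.
move=> y0 e0 ek; rewrite mulrAC ler_pM2r ?invr_gt0//.
by rewrite ler_pdivlMr ?ltr0n// -natrM ler_nat mulnC.
Qed.

Lemma geometric_half (R : realType) (n : nat) :
  \sum_(e < n) 2 ^- e.+1 <= 1 :> R.
Proof.
suff -> : \sum_(e < n) 2 ^- e.+1 = 1 - 2 ^- n :> R.
  by rewrite gerBl invr_ge0 exprn_ge0.
elim: n => [|n IH]; first by rewrite big_ord0 expr0 invr1 subrr.
rewrite big_ord_recr/= IH exprS invfM; move: (2 ^- n) => u; lra.
Qed.

(** With the class of all monic polynomials, [B = 2 / q] and there are at most
    [q ^ e / e] irreducibles of degree [e]. *)
Lemma unrestricted_case (R : realType) :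
  exists C : R, forall (F : finFieldType) (n r : nat)
       (I : 'I_r -> set {poly F}) (m : 'I_r -> nat) (a : F),
     (1 <= n)%N ->
     classical_sets.partition [set: 'I_r] I (irr_le F n) ->
     a != 0 ->
     (ncard (P_ a n `&` sqfree_with_factors I m))%:R
       <= C * ((#|F|%:R : R) `^ (n%:R - 1)
               * poisson_bound (fun i => Hirr R (I i)) m).
Proof.
exists (expR 1 * 2) => F n r I m a n1 part a0.
set q : R := #|F|%:R; have q0 : 0 < q by rewrite ltr0n ltnW// finNzRing_gt1.
set S := [set f : {poly F} | f \is monic].
have -> : P_ a n `&` sqfree_with_factors I m =
    P_ a n `&` S `&` sqfree_with_factors I m.
  by congr (_ `&` _); apply/seteqP; split=> f; [move=> [? ? ?]|case].
have irrE : irr_le F n = [set p | irreducible_in S p /\ (deg p <= n)%N].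
  apply/seteqP; split=> f /= [].
    by move=> mf irf ?; split=> //; apply/irreducible_in_monic.
  by move=> /irreducible_in_monic[].
rewrite irrE in part.
pose rho e : R := if e is 0%N then 0 else e%:R^-1.
have h := @class_count R F S n n r I m a q 0 (2 / q) rho (monic_class F) q0 _ n1
  (leqnn n) a0 part _ _ _.
apply: le_trans (h _ _ _ _) _.
- by rewrite divr_ge0// ltW.
- move=> l [|e] b ul _ lP; first by rewrite mul0r mulr_ge0// ?divr_ge0// ltW.
  have := irreducible_const_count ul lP; rewrite -(ler_nat R) !natrM natrX/=.
  move=> hl; apply: le_trans hl _; rewrite exprS mulrA divfK ?gt_eqF//.
- move=> l [|e] ul lP.
    case: l ul lP => [|p l] _ lP; first by rewrite mul0r.
    by have [[_ + _] dp] := lP p (mem_head _ _); rewrite dp.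
  have qe : 0 < q ^+ e.+1 by rewrite exprn_gt0.
  apply: le_trans (count_ratio qe (ltn0Sn e) (irreducible_count ul lP)) _.
  by rewrite natrX divff ?div1r// expf_neq0// gt_eqF.
- by rewrite add0r big_ord_recl/= add0r.
rewrite add0r -!mulrA ler_pM2l ?expR_gt0// ler_pM2l//.
have -> : (fun i => Hirr R (I i)) = (fun i => \sum_(p \in I i) q ^- deg p).
  by apply/funext => i; rewrite HirrE.
rewrite powRB; last by rewrite (gt_eqF q0) implybT.
by rewrite powRr1 ?(ltW q0)// powR_mulrn ?(ltW q0)// mulrA [q^-1 * _]mulrC.
Qed.

(** Weights are powers of [x = q ^ (1 / 2)].  In the harmonic sum, degree
    [2 j] contributes at most [1 / j], and the at most two linear polynomials
    a bounded amount. *)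
Lemma star_case (R : realType) :
  exists C : R, forall (F : finFieldType) (n r : nat)
       (I : 'I_r -> set {poly F}) (m : 'I_r -> nat),
     (1 <= n)%N ->
     classical_sets.partition [set: 'I_r] I (irr_star_le F (2 * n)) ->
     (ncard (Pstar (1 : F) (2 * n) `&` sqfree_with_factors I m))%:R
       <= C * ((#|F|%:R : R) `^ n%:R
               * poisson_bound (fun i => Hsym R (I i)) m).
Proof.
exists (expR (2 + 1) * 2) => F n r I m n1 part.
set q : R := #|F|%:R; have q1 : 1 < q by rewrite ltr1n finNzRing_gt1.
have q0 : 0 < q by apply: lt_trans q1.
set x := Num.sqrt q; have x0 : 0 < x by rewrite sqrtr_gt0.
have x1 : 1 <= x by rewrite -sqrtr1 ler_sqrt// ltW.
have xx : x ^+ 2 = q by rewrite sqr_sqrtr// ltW.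
have xe j : x ^+ j.*2 = q ^+ j by rewrite -mul2n exprM xx.
rewrite /irr_star_le star_symmetricE in part.
rewrite /Pstar star_symmetricE.
have cls := @dagger_class F 1 isT.
pose rho e : R := if odd e then (if e == 1%N then 2 else 0)
  else if e is 0%N then 0 else (e./2)%:R^-1.
have h := @class_count R F _ n (2 * n) r I m 1 x 2 2 rho cls x0 _ n1
  _ (oner_neq0 _) part _ _ _.
apply: le_trans (h _ _ _ _ _) _ => //.
- by rewrite leq_pmull.
- move=> l e b ul _ lP'.
  have lP : {in l, forall p,
      irreducible_in (dagger_symmetric F 1) p /\ deg p = e}.
    by move=> p /lP'[].
  have [oe|ee] := boolP (odd e).
    have := star_odd_count ul oe lP; case: eqP => [->|_].
      rewrite mul1r expr1 => hl.
      by apply: (@le_trans _ _ 2); rewrite ?ler_nat// ler_peMr.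
    by rewrite leqn0 => /eqP ->; rewrite mulr0 mulr_ge0// exprn_ge0// ltW.
  have [j eE] : exists j, e = j.*2.
    by exists e./2; rewrite -[LHS]odd_double_half (negPf ee).
  rewrite eE in lP *; have := star_even_count ul lP.
  rewrite xe -natrX -!natrM ler_nat => hl.
  by rewrite -mul2n -mulnA leq_mul2l.
- move=> l e ul lP; rewrite /rho; have [oe|ee] := boolP (odd e).
    have := star_odd_count ul oe lP; case: eqP => [->|_] hl.
      rewrite expr1 ler_pdivrMr// (@le_trans _ _ 2) ?ler_nat// ler_peMr//.
    by move: hl; rewrite leqn0 => /eqP ->; rewrite mul0r.
  case: e ee lP => [|e] ee lP.
    case: l ul lP => [|p l] _ lP; first by rewrite mul0r.
    by have [[_ + _] dp] := lP p (mem_head _ _); rewrite dp.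
  have eE : e.+1 = e.+1./2.*2 by rewrite -[LHS]odd_double_half (negPf ee).
  move: (e.+1./2) eE => j eE; have j0 : (0 < j)%N by rewrite -double_gt0 -eE.
  have qj : 0 < q ^+ j by rewrite exprn_gt0.
  rewrite eE xe in lP *.
  apply: le_trans (count_ratio qj j0 (star_even_count ul lP)) _.
  by rewrite natrX divff ?div1r// expf_neq0// gt_eqF.
- rewrite mul2n; case: n n1 {part h} => // n _.
  elim: n => [|n IH].
    by rewrite !big_ord_recl !big_ord0/= /rho/= !addr0 add0r.
  rewrite doubleS big_ord_recr big_ord_recr [in leRHS]big_ord_recr/=.
  rewrite [leRHS]addrA -addrA; apply: lerD => //.
  by rewrite /rho /= !negbK uphalf_double odd_double/= add0r half_double.
have -> : (fun i => Hsym R (I i)) = (fun i => \sum_(p \in I i) x ^- deg p).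
  by apply/funext => i; rewrite HsymE.
by rewrite mul2n xe powR_mulrn// ltW.
Qed.

(** Weights are powers of [x = s], and the gain of [s] from the constant term
    is [B = 1 / s].  The term [+ 1] in the count [(s ^ e + 1) / e] is absorbed in
    a geometric series. *)
Lemma dagger_case (R : realType) :
  exists C : R, forall (F : finFieldType) (s : nat) (n r : nat)
       (I : 'I_r -> set {poly F}) (m : 'I_r -> nat) (a : F),
     #|F| = (s ^ 2)%N ->
     (1 <= n)%N ->
     classical_sets.partition [set: 'I_r] I (irr_dagger_le F s n) ->
     a != 0 ->
     (ncard (Pdagger s a n `&` sqfree_with_factors I m))%:R
       <= C * ((#|F|%:R : R) `^ ((n%:R - 1) / 2)
               * poisson_bound (fun i => Hsym R (I i)) m).
Proof.
exists (expR (1 + 1)) => F s n r I m a cardF n1 part a0.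
have s1 := sqrt_card_gt1 cardF.
set q : R := #|F|%:R; set x : R := s%:R.
have x0 : 0 < x by rewrite ltr0n ltnW.
have xq : Num.sqrt q = x by rewrite /q cardF natrX sqrtr_sqr ger0_norm.
have cls := dagger_class (sqrt_card_pchar cardF).
pose rho e : R := if e is 0%N then 0 else e%:R^-1 + 2 ^- e.
have h := @class_count R F _ n n r I m a x 1 x^-1 rho cls x0 _ n1
  (leqnn n) a0 part _ _ _.
apply: le_trans (h _ _ _ _) _.
- by rewrite invr_ge0 ltW.
- move=> l [|e] b ul _ lP; first by rewrite mul0r mulr_ge0// ?invr_ge0// ltW.
  have := dagger_const_count cardF ul lP; rewrite -(ler_nat R) !natrM natrX/=.
  by move=> hl; apply: le_trans hl _; rewrite exprS mulrA mulVf ?mul1r// gt_eqF.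
- move=> l [|e] ul lP.
    case: l ul lP => [|p l] _ lP; first by rewrite mul0r.
    by have [[_ + _] dp] := lP p (mem_head _ _); rewrite dp.
  have xe : 0 < x ^+ e.+1 by rewrite exprn_gt0.
  apply: le_trans (count_ratio xe (ltn0Sn e) (dagger_count cardF ul lP)) _.
  rewrite natrD natrX mulrDl divff ?expf_neq0 ?gt_eqF// mulrDl !div1r lerD2l.
  apply: (@le_trans _ _ (x ^- e.+1)).
    by rewrite ler_pdivrMr// ler_peMr ?ler1n// invr_ge0 exprn_ge0// ltW.
  by rewrite lef_pV2 ?posrE ?exprn_gt0// lerXn2r ?nnegrE ?(ltW x0)// ler_nat.
- rewrite big_ord_recl/= add0r big_split/= [leRHS]addrC lerD2l.
  exact: geometric_half.
rewrite -!mulrA ler_pM2l ?expR_gt0//.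
have -> : (fun i => Hsym R (I i)) = (fun i => \sum_(p \in I i) x ^- deg p).
  by apply/funext => i; rewrite HsymE -/q xq.
have -> : (n%:R - 1) / 2 = n.-1%:R / 2 :> R by rewrite -subn1 natrB.
rewrite powR_half// xq mulrA; case: (n) n1 => // k _.
by rewrite exprS mulrA mulVf ?mul1r// gt_eqF.
Qed.

Theorem proposition2p2 (R : realType) :
  [/\
   exists C : R, forall (F : finFieldType) (n r : nat)
       (I : 'I_r -> set {poly F}) (m : 'I_r -> nat) (a : F),
     (1 <= n)%N ->
     classical_sets.partition [set: 'I_r] I (irr_le F n) ->
     a != 0 ->
     (ncard (P_ a n `&` sqfree_with_factors I m))%:R
       <= C * ((#|F|%:R : R) `^ (n%:R - 1)
               * poisson_bound (fun i => Hirr R (I i)) m),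
   exists C : R, forall (F : finFieldType) (n r : nat)
       (I : 'I_r -> set {poly F}) (m : 'I_r -> nat),
     (1 <= n)%N ->
     classical_sets.partition [set: 'I_r] I (irr_star_le F (2 * n)) ->
     (ncard (Pstar (1 : F) (2 * n) `&` sqfree_with_factors I m))%:R
       <= C * ((#|F|%:R : R) `^ n%:R
               * poisson_bound (fun i => Hsym R (I i)) m)
   & exists C : R, forall (F : finFieldType) (s : nat) (U : {group {unit F}})
       (n r : nat) (I : 'I_r -> set {poly F}) (m : 'I_r -> nat)
       (a : {unit F}),
     #|F| = (s ^ 2)%N ->
     cyclic U -> #|U| = (s + 1)%N ->
     (1 <= n)%N ->
     classical_sets.partition [set: 'I_r] I (irr_dagger_le F s n) ->
     a \in U ->
     (ncard (Pdagger s (val a) n `&` sqfree_with_factors I m))%:R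
       <= C * ((#|F|%:R : R) `^ ((n%:R - 1) / 2)
               * poisson_bound (fun i => Hsym R (I i)) m)].
Proof.
split; [exact: unrestricted_case|exact: star_case|].
have [C hC] := dagger_case R; exists C => F s U n r I m a cardF _ _ n1 part _.
by apply: hC => //; rewrite -unitfE; exact: valP.
Qed.
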